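(* Let $d\ge 1$, let $T>0$, let $\Omega\subset\mathbb{R}^d$ be a bounded open domain, and let $\mathbf{A}:\mathbb{R}^d\times[0,T]\to\mathbb{R}^d$ be continuous with continuous first-order partial derivatives and with $\sup_{\mathbf{x}\in\mathbb{R}^d,\,t\in[0,T]}\|\nabla_{\mathbf{x}}\mathbf{A}(\mathbf{x},t)\|_{\mathrm{op}}\le L_A$ for some constant $L_A>0$. Let $\widetilde{\Omega}(t)=\operatorname{D}^{\mathbf{A}}_{T\to t}(\Omega)$ and let $\widetilde{U}_0\in L^2(\widetilde{\Omega}(0))$. Then the solution $U(\mathbf{x},t)$ of the integral invariant model with initial data $\widetilde{U}_0$ satisfies $$U(\mathbf{x},t)\in L^q([0,T],H(\widetilde{\Omega}(t)))\qquad\text{for all }1\le q\le\infty,$$ and $$\|U\|_{L^\infty([0,T],H(\widetilde{\Omega}(t)))}=\lim_{q\to\infty}\|U\|_{L^q([0,T],H(\widetilde{\Omega}(t)))}.$$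
   Context: All functions are real-valued. $\nabla_{\mathbf{x}}\mathbf{A}$ is the spatial Jacobian matrix and $\|\cdot\|_{\mathrm{op}}$ is the operator norm induced by the Euclidean norm. Flow map. Under the stated assumptions on $\mathbf{A}$, for all $t_1,t_2\in[0,T]$ the map $\operatorname{D}^{\mathbf{A}}_{t_1\to t_2}:\mathbb{R}^d\to\mathbb{R}^d$ is defined by $\operatorname{D}^{\mathbf{A}}_{t_1\to t_2}(\mathbf{x})=\mathbf{s}(t_2)=\mathbf{x}+\int_{t_1}^{t_2}\mathbf{A}(\mathbf{s}(\tau),\tau)\,\mathrm{d}\tau$, where $\mathbf{s}$ is the solution on $[0,T]$ of $\frac{\mathrm{d}\mathbf{s}}{\mathrm{d}\tau}=\mathbf{A}(\mathbf{s},\tau)$ with $\mathbf{s}(t_1)=\mathbf{x}$. It is invertible with inverse $\operatorname{D}^{\mathbf{A}}_{t_2\to t_1}$. Function spaces. $H(G)$ denotes $L^2(G)$ with the $L^2$-inner product. $H_0(\Omega)=\{f\in L^2(\mathbb{R}^d):\operatorname{supp} f\subset\subset\Omega\}$ (the support is a compact subset of $\Omega$). For $1\le q\le\infty$, $L^q([0,T],H(\widetilde{\Omega}(t)))$ is the set of $U$ such that $U(\cdot,t)\in L^2(\widetilde{\Omega}(t))$ for every $t\in[0,T]$ and the map $t\mapsto\|U(\cdot,t)\|_{L^2(\widetilde{\Omega}(t))}$ belongs to $L^q([0,T])$; its norm is $\|U\|_{L^q([0,T],H(\widetilde{\Omega}(t)))}=\left(\int_0^T\|U(\cdot,t)\|_{L^2(\widetilde{\Omega}(t))}^q\,\mathrm{d}t\right)^{1/q}$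 for $q<\infty$, and the essential supremum over $t\in[0,T]$ of $\|U(\cdot,t)\|_{L^2(\widetilde{\Omega}(t))}$ for $q=\infty$. Test functions. For $\Psi\in H_0(\Omega)$ and $t\in[0,T]$, $\psi(\mathbf{x},t)=\operatorname{\Phi}^{\mathbf{A}}_{T\to t}[\Psi](\mathbf{x}):=\Psi(\operatorname{D}^{\mathbf{A}}_{t\to T}(\mathbf{x}))$ for $\mathbf{x}\in\widetilde{\Omega}(t)$. Solution of the integral invariant model. Given $\widetilde{U}_0\in L^2(\widetilde{\Omega}(0))$ (extended by zero to $\mathbb{R}^d$), a function $U\in L^1([0,T],H(\widetilde{\Omega}(t)))$ is a solution of the integral invariant model with initial data $\widetilde{U}_0$ if $U(\cdot,0)=\widetilde{U}_0$ in $\widetilde{\Omega}(0)$ and, for every $\Psi\in H_0(\Omega)$, with $\psi(\mathbf{x},t)=\Psi(\operatorname{D}^{\mathbf{A}}_{t\to T}(\mathbf{x}))$ for $\mathbf{x}\in\widetilde{\Omega}(t)$, $t\in[0,T]$, one has $\frac{\mathrm{d}}{\mathrm{d}t}\int_{\widetilde{\Omega}(t)}U(\mathbf{x},t)\psi(\mathbf{x},t)\,\mathrm{d}\mathbf{x}=0$ on $[0,T]$; equivalently, $\int_{\widetilde{\Omega}(t)}U(\mathbf{x},t)\psi(\mathbf{x},t)\,\mathrm{d}\mathbf{x}=\int_{\widetilde{\Omega}(0)}\widetilde{U}_0(\mathbf{x})\psi(\mathbf{x},0)\,\mathrm{d}\mathbf{x}$ for all $t\in[0,T]$. Equality of $L^2$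 functions is almost-everywhere equality. *)

(* Defs.v *)
From HB Require Import structures.
From mathcomp Require Import all_boot all_order all_algebra.
From mathcomp Require Import all_classical all_reals all_analysis.

Set Implicit Arguments.
Unset Strict Implicit.
Unset Printing Implicit Defensive.

Import Order.TTheory GRing.Theory Num.Theory.
Import numFieldNormedType.Exports.

Local Open Scope classical_set_scope.
Local Open Scope ring_scope.

(* Points of R^d, d >= 1, are row vectors 'rV[R]_n.+1 (so d = n.+1).  The
   library topology on row vectors is that of the max norm, hence the usual
   one; the Euclidean norm matters only for the operator norm below. *)

Section lebesgue_measure_rV.
Context {R : realType} {n : nat}.
Implicit Types (a b : 'rV[R]_n.+1) (X : set 'rV[R]_n.+1).

Definition box a b : set 'rV[R]_n.+1 :=
  [set x | forall i, a 0 i < x 0 i <= b 0 i].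

(* The truncation at 0 gives volume 0 to degenerate boxes. *)
Definition box_volume a b : R := \prod_i Num.max 0 (b 0 i - a 0 i).

Definition box_cover X : set (nat -> 'rV[R]_n.+1 * 'rV[R]_n.+1) :=
  [set B | X `<=` \bigcup_k box (B k).1 (B k).2].

Definition lebesgue_outer X : \bar R :=
  ereal_inf [set (\sum_(k <oo) (box_volume (B k).1 (B k).2)%:E)%E
            | B in box_cover X].

Let vol (c : 'rV[R]_n.+1 * 'rV[R]_n.+1) : \bar R := (box_volume c.1 c.2)%:E.

Let vol_ge0 c : (0 <= vol c)%E.
Proof. by rewrite lee_fin prodr_ge0// => i _; rewrite le_max lexx. Qed.

Let lebesgue_outer_ge0 X : (0 <= lebesgue_outer X)%E.
Proof.
by apply: le_ereal_inf_tmp => _ [B _ <-]; apply: nneseries_ge0 => *; exact: vol_ge0.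
Qed.

Let lebesgue_outer0 : lebesgue_outer set0 = 0%E.
Proof.
apply/eqP; rewrite eq_le lebesgue_outer_ge0 andbT.
apply: ereal_inf_lbound; exists (fun=> (0, 0)); first by [].
apply: eseries0 => k _ _ /=; congr EFin.
by rewrite /box_volume big_ord_recl mxE subrr maxxx mul0r.
Qed.

Let le_lebesgue_outer : {homo lebesgue_outer : X Y / X `<=` Y >-> (X <= Y)%E}.
Proof.
move=> X Y XY; apply/ereal_inf_le_tmp => _ [B BY <-].
by exists B => //; exact: subset_trans XY BY.
Qed.

Let lebesgue_outer_sigma_subadditive : sigma_subadditive lebesgue_outer.
Proof.
move=> A; have [[i ioo]|] := pselect (exists i, lebesgue_outer (A i) = +oo%E).
  rewrite (eseries_pinfty _ _ ioo) ?leey// => k _.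
  by rewrite -ltNye (lt_le_trans _ (lebesgue_outer_ge0 _)).
rewrite -forallNE => Aoo.
suff add2e (e : {posnum R}) : (lebesgue_outer (\bigcup_k A k) <=
    \sum_(i <oo) lebesgue_outer (A i) + e%:num%:E)%E.
  by apply/lee_addgt0Pr => _/posnumP[].
rewrite (le_trans _ (epsilon_trick _ _ _))//.
pose P k B := box_cover (A k) B /\ (\sum_(j <oo) vol (B j) <=
  lebesgue_outer (A k) + (e%:num / (2 ^ k.+1)%:R)%:E)%E.
have [G PG] : {G : nat -> nat -> 'rV[R]_n.+1 * 'rV[R]_n.+1 &
    forall k, P k (G k)}.
  apply: (@choice _ _ P) => k; rewrite /P.
  have fk : lebesgue_outer (A k) \is a fin_num.
    by rewrite ge0_fin_numE// ltey; apply/eqP; exact: Aoo.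
  have ek : (0 < e%:num / (2 ^ k.+1)%:R)%R by [].
  have [_ [B AB <-] lt] := lb_ereal_inf_adherent ek fk.
  by exists B; split => //; exact: ltW.
have volG_ge0 x : (0 <= (vol \o uncurry G) x)%E by exact: vol_ge0.
apply: (@le_trans _ _ (\esum_(i in setT) (vol \o uncurry G) i)%E).
  apply: ereal_inf_lbound => /=.
  have /card_esym/ppcard_eqP[f] := card_nat2.
  exists (uncurry G \o f).
    move=> t [k _ Akt]; have [j _ Gkj] := (PG k).1 _ Akt.
    by exists (f^-1%FUN (k, j)) => //=; rewrite invK ?inE.
  rewrite -(esum_pred_image (vol \o uncurry G) _ xpredT) ?[fun=> _]set_true//.
  by rewrite image_eq.
rewrite (_ : esum _ _ = \sum_(i <oo) \sum_(j <oo) vol (G i j))%E; last first.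
  pose J : nat -> set (nat * nat) := fun i => [set (i, j) | j in setT].
  rewrite (_ : setT = \bigcup_k J k); last first.
    by rewrite predeqE => -[a b]; split => // _; exists a => //; exists b.
  rewrite esum_bigcupT /=; last 2 first.
    - apply/trivIsetP => i j _ _ ij.
      rewrite predeqE => -[k m] /=; split => //= -[] [_] _ [<-{k} _].
      by move=> [m' _] [] /esym/eqP; rewrite (negbTE ij).
    - by move=> [k m]; exact: volG_ge0.
  rewrite -(image_id [set: nat]) -fun_true esum_pred_image//; last first.
    by move=> k _; exact: esum_ge0.
  apply: eq_eseriesr => /= j _.
  rewrite -(esum_pred_image (vol \o uncurry G) (pair j) predT)//=; last first.
    by move=> ? ? _ _; exact: (@can_inj _ _ _ snd).
  by congr esum; rewrite predeqE => -[a b]; split; move=> [i _ <-]; exists i.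
apply: lee_lim.
- apply: is_cvg_nneseries => k *.
  by apply: nneseries_ge0 => m *; exact: (volG_ge0 (k, m)).
- by apply: is_cvg_nneseries => k *; apply: adde_ge0.
- by near=> k; apply: lee_sum => i _; exact: (PG i).2.
Unshelve. all: by end_near. Qed.

HB.instance Definition _ := isOuterMeasure.Build R 'rV[R]_n.+1 lebesgue_outer
  lebesgue_outer0 lebesgue_outer_ge0 le_lebesgue_outer
  lebesgue_outer_sigma_subadditive.

(* The complete Lebesgue measure on R^d, on the sigma-algebra of the
   Lebesgue (i.e. Caratheodory) measurable sets. *)
Definition lebesgue_rV : set (caratheodory_type lebesgue_outer) -> \bar R :=
  lebesgue_outer.

HB.instance Definition _ := isMeasure.Build _ _ _ lebesgue_rV
  (@caratheodory_measure0 _ _ lebesgue_outer)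
  (@caratheodory_measure_ge0 _ _ lebesgue_outer)
  (@caratheodory_measure_sigma_additive _ _ lebesgue_outer).

End lebesgue_measure_rV.
Arguments lebesgue_rV : clear implicits.

(* L^p of a measurable set G: functions are identified with their extension
   by zero, so the values of f off G are irrelevant.  On G = [0, T] the norm
   for p = +oo is the essential supremum over [0, T]. *)
Definition in_Lp {R : realType} {disp} {X : measurableType disp}
    (mu : {measure set X -> \bar R}) (G : set X) (p : \bar R) (f : X -> R) :=
  f \_ G \in Lfun mu p.

Definition Lp_norm {R : realType} {disp} {X : measurableType disp}
    (mu : {measure set X -> \bar R}) (G : set X) (p : \bar R) (f : X -> R) :=
  Lnorm mu p (EFin \o (f \_ G)).

(* Derivative at t of a curve defined on D (one-sided at endpoints). *)
Definition deriv_within {R : realType} {V : normedModType R} (D : set R)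
    (s : R -> V) (t : R) (l : V) :=
  (fun u => (u - t)^-1 *: (s u - s t)) @ within D t^' --> l.

Section velocity.
Context {R : realType} {n : nat}.
Implicit Types (T t : R) (A : 'rV[R]_n.+1 -> R -> 'rV[R]_n.+1).
Implicit Types (x : 'rV[R]_n.+1).

Definition euclid_norm (v : 'cV[R]_n.+1) : R :=
  Num.sqrt (\sum_i v i 0 ^+ 2).

Definition op_norm (M : 'M[R]_n.+1) : R :=
  sup [set euclid_norm (M *m v) | v in [set v | euclid_norm v <= 1]].

Definition partial_x (j : 'I_n.+1) A t x : 'rV[R]_n.+1 :=
  'D_(delta_mx 0 j) (A ^~ t) x.

(* Entry (i, j) is the partial derivative of A_i in x_j; the library's
   [jacobian] is the transpose, being meant to act on row vectors. *)
Definition spatial_jacobian A t x : 'M[R]_n.+1 :=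
  \matrix_(i, j) partial_x j A t x 0 i.

(* Continuity of F on R^d x [0, T]. *)
Definition slab_continuous T (F : 'rV[R]_n.+1 -> R -> 'rV[R]_n.+1) :=
  {within [set xt : 'rV[R]_n.+1 * R | xt.2 \in `[0, T]],
    continuous (fun xt => F xt.1 xt.2)}.

(* C^1 on R^d x [0, T], the derivative in t being one-sided at 0 and T. *)
Definition C1_velocity T A :=
  [/\ slab_continuous T A,
      forall j : 'I_n.+1,
        (forall x t, t \in `[0, T] -> derivable (A ^~ t) x (delta_mx 0 j)) /\
        slab_continuous T (fun x t => partial_x j A t x)
    & exists2 dtA : 'rV[R]_n.+1 -> R -> 'rV[R]_n.+1,
        forall x t, t \in `[0, T] ->
          deriv_within `[0, T] (A x) t (dtA x t)
        & slab_continuous T dtA].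

Definition ode_solution T A (t1 : R) x : set (R -> 'rV[R]_n.+1) :=
  [set s | s t1 = x /\
    forall t, t \in `[0, T] -> deriv_within `[0, T] s t (A (s t) t)].

(* D^A_{t1 -> t2}: [get] picks a solution; under the assumptions on A its
   restriction to [0, T] is unique. *)
Definition flow T A (t1 t2 : R) x : 'rV[R]_n.+1 :=
  get (ode_solution T A t1 x) t2.

Definition moving_domain T A (Omega : set 'rV[R]_n.+1) t :
    set 'rV[R]_n.+1 :=
  flow T A T t @` Omega.

End velocity.

Section integral_invariant_model.
Context {R : realType} {n : nat}.
Local Notation leb := (lebesgue_rV R n).
Implicit Types (T : R) (A : 'rV[R]_n.+1 -> R -> 'rV[R]_n.+1).
Implicit Types (Omega G : set 'rV[R]_n.+1) (f Psi : 'rV[R]_n.+1 -> R).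
Implicit Types (U : 'rV[R]_n.+1 -> R -> R) (q : \bar R).

(* Complement of the largest open set on which f vanishes a.e.: the support of
   the L^2 class of f. *)
Definition ess_support f : set 'rV[R]_n.+1 :=
  [set x | forall V, nbhs x V -> ~ {ae leb, forall y, V y -> f y = 0}].

Definition in_L2 G f := in_Lp leb G 2%:E f.

Definition in_H0 Omega Psi :=
  [/\ in_L2 setT Psi, compact (ess_support Psi) & ess_support Psi `<=` Omega].

Definition slice_norm T A Omega U (t : R) : R :=
  fine (Lp_norm leb (moving_domain T A Omega t) 2%:E (U ^~ t)).

Definition in_LqH T A Omega q U :=
  (forall t, t \in `[0, T] -> in_L2 (moving_domain T A Omega t) (U ^~ t)) /\
  in_Lp (@completed_lebesgue_measure R) `[0, T] q (slice_norm T A Omega U).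

Definition LqH_norm T A Omega q U : \bar R :=
  Lp_norm (@completed_lebesgue_measure R) `[0, T] q (slice_norm T A Omega U).

Definition test_function T A Psi (x : 'rV[R]_n.+1) (t : R) : R :=
  Psi (flow T A t T x).

Definition model_solution T A Omega (U0 : 'rV[R]_n.+1 -> R) U :=
  [/\ in_LqH T A Omega 1%:E U,
      {ae leb, forall x, moving_domain T A Omega 0 x -> U x 0 = U0 x}
    & forall Psi, in_H0 Omega Psi -> forall t, t \in `[0, T] ->
        deriv_within `[0, T]
          (fun u => \int[leb]_(x in moving_domain T A Omega u)
                      (U x u * test_function T A Psi x u) : R) t 0].

End integral_invariant_model.

(* Main.v *)
Require Import Defs.
From mathcomp Require Import all_boot all_order all_algebra.
From mathcomp Require Import all_classical all_reals all_analysis.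
From mathcomp Require Import measurable_realfun ess_sup_inf ring lra.
Import Order.TTheory GRing.Theory Num.Theory.
Import numFieldNormedType.Exports.
Local Open Scope classical_set_scope.
Local Open Scope ring_scope.

(* The velocity is Lipschitz in space, so by Picard iteration and Gronwall its
   flow maps are bi-Lipschitz with a constant that does not depend on the times;
   hence they distort Lebesgue measure by at most some constant C.  Let Psi be
   U(., t) composed with the flow from T to t and cut off to a compact subset of
   Omega.  The conserved quantity tested against Psi is, at time t, the integral
   H of U(., t)^2 over a compact part of the domain; at time 0 it is at most
   C^2/2 |U(., 0)|^2 + H/2 by Young's inequality.  Thus H <= C^2 |U(., 0)|^2, and
   exhausting Omega shows that the L^2 norm of the slices is bounded on [0, T].
   Since [0, T] has finite measure, all L^q norms are finite and converge to the
   L^oo norm. *)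

(** * Lebesgue measurability and Lipschitz maps *)

(** The distortion bound uses no Jacobian determinant. Lebesgue measure is here the Caratheodory
    measure of an outer measure, and a covering argument shows that a [K]-Lipschitz map multiplies
    the outer measure of any set by at most [(6 * K) ^+ n.+1]. Applied to a map and to its inverse,
    this yields measurability for the complete sigma-algebra, which continuity alone does not give,
    and an inequality between integrals of nonnegative functions. The estimate tests the solution
    against itself. Comparing times t and T costs one factor [C], comparing T and 0 another; Young's
    inequality is therefore used with weight [C ^+ 2], which leaves exactly H/2. This term can be
    absorbed because H is finite, each slice being in L^2. The cut-off is forced by the compact
    support of the test functions in the open set Omega. Measurability in t of the slice norm is
    contained in the membership of [U] in L^1. *)

Lemma mx_norm_coord (R : realType) (n : nat) (v : 'rV[R]_n) i : `|v 0 i| <= `|v|.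
Proof.
have -> : `|v| = \big[Num.max/0]_ij `|v ij.1 ij.2| by exact: mx_normrE.
exact: (le_bigmax_cond 0 (fun ij : 'I_1 * 'I_n => `|v ij.1 ij.2|) (erefl : xpredT (0, i))).
Qed.

Lemma mx_norm_le_coord (R : realType) (n : nat) (v : 'rV[R]_n) (e : R) :
  0 <= e -> (forall i, `|v 0 i| <= e) -> `|v| <= e.
Proof.
move=> e0 ve; have -> : `|v| = \big[Num.max/0]_ij `|v ij.1 ij.2| by exact: mx_normrE.
apply/bigmax_leP; split=> // -[i j] _.
by rewrite /= ord1; exact: ve.
Qed.

(** * Caratheodory measurability of half-spaces, boxes, open and closed sets *)

Section box_measure.
Context {R : realType} {n : nat}.
Local Notation V := 'rV[R]_n.+1.
Local Notation outer := (@lebesgue_outer R n).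
Local Notation Lmeas := (measurable : set (set (caratheodory_type outer))).

Lemma box_volume_ge0 (a b : V) : 0 <= box_volume a b.
Proof. by apply: prodr_ge0 => i _; rewrite le_max lexx. Qed.

Lemma lebesgue_outer_box_le (a b : V) : (outer (box a b) <= (box_volume a b)%:E)%E.
Proof.
apply: ereal_inf_lbound.
exists (fun k => if k == 0%N then (a, b) else (0, 0)).
  by move=> x abx; exists 0%N.
rewrite nneseries_recl//; last by move=> k _; rewrite lee_fin box_volume_ge0.
rewrite eseries0 ?adde0// => -[//|k] _ _ /=; congr EFin.
by rewrite /box_volume big_ord_recl mxE subrr maxxx mul0r.
Qed.

(** A hyperplane orthogonal to the i-th axis cuts the box in two. The truncation at 0 in
    [box_volume] makes the identity hold even if the hyperplane misses the box or the box is
    empty. *)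
Lemma box_volume_split (a b : V) i c :
  box_volume a b =
  box_volume a (\row_j if j == i then Num.min (b 0 j) c else b 0 j) +
  box_volume (\row_j if j == i then Num.max (a 0 j) c else a 0 j) b.
Proof.
have volE (u v : V) : box_volume u v = Num.max 0 (v 0 i - u 0 i) *
    \prod_(j | j != i) Num.max 0 (v 0 j - u 0 j) by rewrite /box_volume (bigD1 i).
rewrite !volE !mxE eqxx.
set p := (X in _ * X = _ * _ + _ * _).
under [X in _ = _ * X + _]eq_bigr => j ji do rewrite mxE (negbTE ji).
under [X in _ = _ + _ * X]eq_bigr => j ji do rewrite mxE (negbTE ji).
rewrite -/p -mulrDl; congr (_ * _).
rewrite !maxEle !minEle.
by repeat case: ifPn; rewrite -?ltNge; lra.
Qed.

(** Cutting every box of a cover of [X] along the hyperplane gives covers of the two parts of [X]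
    with the same total volume, which is the Caratheodory criterion. *)
Lemma half_space_measurable i c : Lmeas [set x : V | x 0 i <= c].
Proof.
apply: (@le_caratheodory_measurable _ _ outer) => X.
apply: le_ereal_inf_tmp => _ [B XB <-].
pose bl k : V := \row_j if j == i then Num.min ((B k).2 0 j) c else (B k).2 0 j.
pose ar k : V := \row_j if j == i then Num.max ((B k).1 0 j) c else (B k).1 0 j.
apply: (@le_trans _ _ (\sum_(k <oo) (box_volume (B k).1 (bl k))%:E +
    \sum_(k <oo) (box_volume (ar k) (B k).2)%:E)%E); last first.
  rewrite -nneseriesD; do ?by move=> *; rewrite lee_fin box_volume_ge0.
  rewrite le_eqVlt; apply/orP; left; apply/eqP/eq_eseriesr => k _.
  by rewrite (box_volume_split (B k).1 (B k).2 i c) EFinD.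
apply: leeD; apply: ereal_inf_lbound.
- exists (fun k => ((B k).1, bl k)) => //= x [/XB[k _ Bx] xc].
  exists k => //= j; have /andP[-> /= bj] := Bx j; rewrite mxE.
  by case: eqP => // ji; rewrite le_min bj ji.
- exists (fun k => (ar k, (B k).2)) => //= x [/XB[k _ Bx] /negP xc].
  exists k => //= j; have /andP[aj ->] := Bx j; rewrite andbT mxE.
  by case: eqP => // ji; rewrite gt_max aj ji ltNge.
Qed.

Lemma box_measurable (a b : V) : Lmeas (box a b).
Proof.
rewrite (_ : box a b = \bigcap_(i in [set: 'I_n.+1])
    ([set x : V | x 0 i <= b 0 i] `\` [set x : V | x 0 i <= a 0 i])).
  apply: fin_bigcap_measurable => [|i _]; first exact: finite_finset.
  by apply: measurableD; exact: half_space_measurable.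
apply/seteqP; split=> x abx i.
  by move=> _; split; have /andP[? ?] := abx i => //=; apply/negP; rewrite -ltNge.
by have [? /negP] := abx i I; rewrite -ltNge => ->.
Qed.

(** Rational corners make the family of boxes countable, so that every open set is a countable union
    of boxes. *)
Lemma box_sub_ball (x : V) (e : R) : 0 < e -> exists p : 'rV[rat]_n.+1 * 'rV[rat]_n.+1,
  box (map_mx ratr p.1) (map_mx ratr p.2) x /\
  box (map_mx ratr p.1) (map_mx ratr p.2) `<=` ball x e.
Proof.
move=> e0.
have /choice[a ha] : forall i, exists q : rat, x 0 i - e < ratr q < x 0 i.
  move=> i; have [|q] := @rat_in_itvoo R (x 0 i - e) (x 0 i); first lra.
  by rewrite in_itv; exists q.
have /choice[b hb] : forall i, exists q : rat, x 0 i < ratr q < x 0 i + e.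
  move=> i; have [|q] := @rat_in_itvoo R (x 0 i) (x 0 i + e); first lra.
  by rewrite in_itv; exists q.
exists (\row_i a i, \row_i b i); split=> [i|y /= aby].
  by rewrite !mxE; have /andP[_ ->] := ha i; have /andP[/ltW ->] := hb i.
split=> // i j; rewrite ord1 /ball/=.
have := aby j; rewrite !mxE => /andP[? ?].
by have /andP[? ?] := ha j; have /andP[? ?] := hb j; rewrite ltr_norml; apply/andP; split; lra.
Qed.

Lemma open_lebesgue_measurable (O : set V) : open O -> Lmeas O.
Proof.
move=> oO.
pose Q (p : 'rV[rat]_n.+1 * 'rV[rat]_n.+1) : set V :=
  box (map_mx ratr p.1) (map_mx ratr p.2).
rewrite (_ : O = \bigcup_(p in [set p | Q p `<=` O]) Q p).
  rewrite bigcup_mkcond; apply: countable_bigcupT_measurable => [|p].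
    exact: countableP.
  by case: ifPn => _; [exact: box_measurable|exact: measurable0].
apply/seteqP; split=> [x Ox|x [p /= QO /QO//]].
have /nbhs_ballP[e /= e0 xeO] := open_nbhs_nbhs (conj oO Ox).
have [p [px pO]] := box_sub_ball x e e0.
by exists p => //=; exact: subset_trans pO xeO.
Qed.

Lemma closed_lebesgue_measurable (O : set V) : closed O -> Lmeas O.
Proof.
by move=> cO; rewrite -(setCK O); apply: measurableC; apply: open_lebesgue_measurable; exact: closed_openC.
Qed.

Lemma lebesgue_outer_bigsetU (I : Type) (s : seq I) (X : I -> set V) :
  (outer (\big[setU/set0]_(i <- s) X i) <= \sum_(i <- s) outer (X i))%E.
Proof.
elim: s => [|i s ih]; first by rewrite !big_nil (outer_measure0 outer).
rewrite !big_cons; apply: (le_trans (outer_measureU2 outer _ _)).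
exact: leeD.
Qed.

End box_measure.

(** * Outer measure of Lipschitz images *)

Section lipschitz_image.
Context {R : realType} {n : nat}.
Local Notation V := 'rV[R]_n.+1.
Local Notation outer := (@lebesgue_outer R n).
Variables (F : V -> V) (K : R).
Hypotheses (K0 : 0 < K) (FK : forall x y, `|F x - F y| <= K * `|x - y|).

Lemma lipschitz_image_cube (p : V) (d : R) (X : set V) : 0 < d ->
  (forall x, X x -> forall i, `|x 0 i - p 0 i| <= d) ->
  (outer (F @` X) <= ((3 * K * d) ^+ n.+1)%:E)%E.
Proof.
move=> d0 Xp.
(* The image lies in the closed cube of half-side [K * d] around [F p]; the factor 3/2 leaves room
   for the excluded faces of the half-open [box]. *)
pose h := 3 / 2 * K * d.
have h0 : 0 < h by rewrite /h !mulr_gt0.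
apply: le_trans (le_outer_measure outer _ (box (F p - const_mx h) (F p + const_mx h)) _) _.
  move=> _ [x Xx <-] i; rewrite !mxE.
  have xp : `|x - p| <= d.
    by apply: mx_norm_le_coord => [|j]; [exact: ltW|rewrite !mxE; exact: Xp].
  have : `|F x 0 i - F p 0 i| <= K * d.
    have := mx_norm_coord R _ (F x - F p) i; rewrite !mxE => /le_trans; apply.
    by apply: le_trans (FK _ _) _; rewrite ler_pM2l.
  have Kd : 0 < K * d by rewrite mulr_gt0.
  have hE : h = K * d + K * d / 2 by rewrite /h; lra.
  by rewrite ler_norml hE => /andP[? ?]; apply/andP; split; lra.
apply: le_trans (lebesgue_outer_box_le _ _) _; rewrite lee_fin /box_volume.
rewrite (eq_bigr (fun=> 3 * K * d)) => [|i _].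
  by rewrite prodr_const card_ord.
rewrite !mxE (_ : _ - _ = 3 * K * d); last by rewrite /h; lra.
by apply/max_idPr; rewrite !mulr_ge0// ltW.
Qed.

(** In each direction the factor 3 comes from [lipschitz_image_cube] and the factor 2 from rounding
    up the number of grid cells. *)
Lemma lipschitz_image_box (a b : V) :
  (outer (F @` box a b) <= ((6 * K) ^+ n.+1 * box_volume a b)%:E)%E.
Proof.
have [ab|] := pselect (forall i, a 0 i < b 0 i); last first.
  move=> /existsNP[i] /negP; rewrite -leNgt => ba.
  rewrite (_ : box a b = set0); last first.
    by rewrite -subset0 => x /(_ i) /andP[ax xb]; have := lt_le_trans ax xb; rewrite ltNge ba.
  rewrite image_set0 (outer_measure0 outer) lee_fin mulr_ge0 ?box_volume_ge0//.
  by rewrite exprn_ge0// mulr_ge0// ltW.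
(* The side d of the covering cubes is the shortest side of the box, so that at
   most twice the volume of the box is covered. *)
have [d d0 dab] : exists2 d : R, 0 < d & forall i, d <= b 0 i - a 0 i.
  exists (\big[Num.min/1]_i (b 0 i - a 0 i)) => [|i]; last exact: bigmin_le.
  by apply/bigmin_gtP; split=> // i _; rewrite subr_gt0.
pose N i := (Num.truncn ((b 0 i - a 0 i) / d)).+1.
pose M := \max_i N i.
have NM i : (N i <= M)%N by exact: leq_bigmax.
have Nle i : (N i)%:R * d <= 2 * (b 0 i - a 0 i).
  have : (Num.truncn ((b 0 i - a 0 i) / d))%:R <= (b 0 i - a 0 i) / d.
    by rewrite truncn_le// divr_ge0// ?ltW// subr_gt0.
  by rewrite ler_pdivlMr// => ?; rewrite /N -addn1 natrD mulrDl; have := dab i; lra.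
(* The number of cells depends on the direction, so the grid is the set of functions into the common
   type ['I_M] that stay below [N i] at each [i]. *)
pose fam := family (fun i : 'I_n.+1 => [pred k : 'I_M | (k < N i)%N]).
(* The cube is centred at the lower corner of its grid cell; half-side [d] makes it contain the
   whole cell. *)
pose cube (f : {ffun 'I_n.+1 -> 'I_M}) : set V :=
  [set x | forall i, `|x 0 i - (a 0 i + (f i)%:R * d)| <= d].
have cubeE f : (outer (F @` cube f) <= ((3 * K * d) ^+ n.+1)%:E)%E.
  apply: (@lipschitz_image_cube (\row_i (a 0 i + (f i)%:R * d))) => // x xf i.
  by rewrite mxE; exact: xf.
have cov : F @` box a b `<=` \big[setU/set0]_(f in fam) (F @` cube f).
  move=> _ [x abx <-].
  pose k i := Num.truncn ((x 0 i - a 0 i) / d).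
  have kN i : (k i < N i)%N.
    rewrite ltnS; apply: le_truncn; rewrite ler_pM2r ?invr_gt0// lerB//.
    by have /andP[] := abx i.
  pose f : {ffun 'I_n.+1 -> 'I_M} := [ffun i => Ordinal (leq_trans (kN i) (NM i))].
  have ff : f \in fam by apply/familyP => i; rewrite ffunE inE/= kN.
  rewrite (bigD1 f)//=; left; exists x => // i.
  have /andP[kl kr] : (k i)%:R <= (x 0 i - a 0 i) / d < (k i).+1%:R.
    by apply: truncn_itv; rewrite divr_ge0 ?ltW// subr_gt0; have /andP[] := abx i.
  move: kl kr; rewrite ffunE/= ler_pdivlMr// ltr_pdivrMr// -natr1 mulrDl mul1r => ? ?.
  by rewrite ler_norml; apply/andP; split; lra.
apply: le_trans (le_outer_measure outer _ _ cov) _.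
rewrite -big_filter; apply: le_trans (lebesgue_outer_bigsetU _ _ _) _.
rewrite big_filter/=.
apply: (@le_trans _ _ (\sum_(f in fam) ((3 * K * d) ^+ n.+1)%:E)%E).
  by apply: lee_sum.
rewrite sumEFin lee_fin sumr_const /fam card_family.
rewrite foldrE big_map big_enum/=.
rewrite (eq_bigr N) => [|i _]; last first.
  transitivity (\sum_(j < M | (j < N i)%N) 1)%N; first by rewrite sum1_card.
  by rewrite -(big_ord_widen _ (fun=> 1%N) (NM i)) sum1_card card_ord.
have expE (c : R) : c ^+ n.+1 = \prod_(i in 'I_n.+1) c by rewrite prodr_const card_ord.
rewrite -[leLHS]mulr_natl natr_prod !expE -big_split/= /box_volume -big_split/=.
apply: ler_prod => i _; apply/andP; split; first by rewrite !mulr_ge0// ltW.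
rewrite (max_idPr _) ?subr_ge0; last exact/ltW.
by have := ler_wpM2l (ltW K0) (Nle i); lra.
Qed.

Lemma lipschitz_image_outer (X : set V) :
  (outer (F @` X) <= ((6 * K) ^+ n.+1)%:E * outer X)%E.
Proof.
have C0 : 0 < (6 * K) ^+ n.+1 by rewrite exprn_gt0// mulr_gt0.
rewrite -lee_pdivrMl//; apply: le_ereal_inf_tmp => _ [B XB <-].
rewrite lee_pdivrMl// -nneseriesZl; last first.
  by move=> *; rewrite lee_fin box_volume_ge0.
apply: le_trans (le_outer_measure outer _ (\bigcup_k (F @` box (B k).1 (B k).2)) _) _.
  by move=> _ [x /XB[k _ Bx] <-]; exists k => //; exists x.
apply: le_trans (outer_measure_sigma_subadditive outer _) _.
apply: lee_nneseries => [k _ _|k _]; first exact: (outer_measure_ge0 outer).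
by rewrite -EFinM; exact: lipschitz_image_box.
Qed.

Lemma lipschitz_continuous : continuous F.
Proof.
move=> x; apply/(cvgrPdist_le (FF := nbhs_filter x)) => e e0.
have : nbhs x (ball x (e / K)) by apply: nbhsx_ballx; rewrite divr_gt0.
apply: filterS => y; rewrite -ball_normE /ball_/= ltr_pdivlMr// mulrC => /ltW.
exact: le_trans (FK _ _).
Qed.

End lipschitz_image.

Lemma lebesgue_outer_box_fin (R : realType) (n : nat) (a b : 'rV[R]_n.+1) (X : set 'rV[R]_n.+1) :
  X `<=` box a b -> (lebesgue_outer X < +oo)%E.
Proof.
move=> Xab; apply: le_lt_trans (le_outer_measure lebesgue_outer _ _ Xab) _.
by apply: le_lt_trans (lebesgue_outer_box_le _ _) _; exact: ltry.
Qed.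

(** * Bi-Lipschitz bijections: measurability and integrals *)

Section bilipschitz.
Context {R : realType} {n : nat}.
Local Notation V := 'rV[R]_n.+1.
Local Notation outer := (@lebesgue_outer R n).
Local Notation L := (caratheodory_type outer).
Local Notation Lmeas := (measurable : set (set L)).
Variables (D F : V -> V) (K : R).
Hypotheses (K0 : 0 < K) (FK : forall x y, `|F x - F y| <= K * `|x - y|).
Hypotheses (DK : forall x y, `|D x - D y| <= K * `|x - y|).
Hypotheses (DF : cancel D F) (FD : cancel F D).

Let preimageE X : D @^-1` X = F @` X.
Proof.
apply/seteqP; split=> [x DX|_ [y Xy <-]]; last by rewrite /preimage/= FD.
by exists (D x).
Qed.

Let preimage_outer X : (outer (D @^-1` X) <= ((6 * K) ^+ n.+1)%:E * outer X)%E.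
Proof. by rewrite preimageE; exact: lipschitz_image_outer. Qed.

Let preimage_box a b : Lmeas (D @^-1` box a b).
Proof.
have cD := lipschitz_continuous _ _ K0 DK.
rewrite (_ : D @^-1` box a b = \bigcap_(i in [set: 'I_n.+1])
    ([set x : V | D x 0 i <= b 0 i] `\` [set x : V | D x 0 i <= a 0 i])).
  have cl i c : closed [set x : V | D x 0 i <= c].
    apply: (closed_comp (f := fun x => D x 0 i) (D := [set r | r <= c])) => [x _|].
      by apply: (@continuous_comp _ _ _ D (fun y : V => y 0 i)); [exact: cD|exact: coord_continuous].
    exact: closed_le.
  apply: fin_bigcap_measurable => [|i _]; first exact: finite_finset.
  by apply: measurableD; exact: closed_lebesgue_measurable.
apply/seteqP; split=> x abx i.
  by move=> _; split; have /andP[? ?] := abx i => //=; apply/negP; rewrite -ltNge.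
by have [? /negP] := abx i I; rewrite -ltNge => ->.
Qed.

Let null_measurable (Z : set V) : outer Z = 0%E -> Lmeas Z.
Proof.
move=> Z0; apply: le_caratheodory_measurable => X.
change (outer (X `&` Z) + outer (X `&` ~` Z) <= outer X)%E.
suff -> : outer (X `&` Z) = 0%E.
  by rewrite add0e (le_outer_measure outer)//; apply: subIsetl.
apply/eqP; rewrite eq_le (outer_measure_ge0 outer) andbT -Z0.
by apply: (le_outer_measure outer); exact: subIsetr.
Qed.

Let preimage_fin (E : set V) : Lmeas E -> (outer E < +oo)%E -> Lmeas (D @^-1` E).
Proof.
move=> mE Efin.
have Efn : outer E \is a fin_num by rewrite ge0_fin_numE// (outer_measure_ge0 outer).
(* E is a null set away from a countable intersection G of countable unions of
   boxes, and null sets are preserved by the Lipschitz map F. *)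
have /choice[B HB] : forall k : nat, exists B : nat -> V * V,
    E `<=` \bigcup_j box (B j).1 (B j).2 /\
    (\sum_(j <oo) (box_volume (B j).1 (B j).2)%:E <= outer E + (k.+1%:R^-1)%:E)%E.
  move=> k; have k0 : 0 < (k.+1%:R^-1 : R) by [].
  have [_ [B EB <-] lt] := lb_ereal_inf_adherent k0 Efn.
  by exists B; split => //; exact: ltW.
pose O k : set V := \bigcup_j box (B k j).1 (B k j).2.
pose G : set V := \bigcap_k O k.
have mO k : Lmeas (O k) by apply: bigcupT_measurable => j; exact: box_measurable.
have EG : E `<=` G by move=> x Ex k _; have [+ _] := HB k; exact.
have GE0 : outer (G `\` E) = 0%E.
  apply/eqP; rewrite eq_le (outer_measure_ge0 outer) andbT.
  apply/lee_addgt0Pr => e e0; rewrite add0e.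
  have [k ke] : exists k : nat, k.+1%:R^-1 <= e.
    exists (Num.truncn e^-1); rewrite invf_ple ?posrE//.
    exact/ltW/truncnS_gt.
  apply: (@le_trans _ _ (outer (O k `\` E))).
    by apply: (le_outer_measure outer) => x [Gx Ex]; split=> //; exact: Gx.
  apply: (@le_trans _ _ (k.+1%:R^-1)%:E); last by rewrite lee_fin.
  (* Since [outer E] is finite it may be added to both sides; measurability of [E] then recombines
     the left side into [outer (O k)]. *)
  rewrite -(@leeD2lE _ (outer E))//.
  have -> : (outer E + outer (O k `\` E) = outer (O k))%E.
    have /(_ (O k)) -> := mE; congr (outer _ + outer _)%E.
    by apply/esym/setIidPr; have [] := HB k.
  apply: le_trans (outer_measure_sigma_subadditive outer _) _.
  apply: le_trans (HB k).2.
  apply: lee_nneseries => [j _ _|j _]; first exact: (outer_measure_ge0 outer).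
  exact: lebesgue_outer_box_le.
have -> : E = G `\` (G `\` E) by rewrite setDD; apply/esym/setIidPr.
rewrite (_ : _ @^-1` _ = D @^-1` G `\` D @^-1` (G `\` E))//; apply: measurableD.
  rewrite preimage_bigcap; apply: bigcapT_measurable => k.
  rewrite preimage_bigcup; apply: bigcupT_measurable => j.
  exact: preimage_box.
apply: null_measurable; apply/eqP; rewrite eq_le (outer_measure_ge0 outer) andbT.
by apply: le_trans (preimage_outer _) _; rewrite GE0 mule0.
Qed.

(** Both sides carry the complete sigma-algebra, so null sets have to be pulled back as well as
    Borel sets. The cubes [Q N] reduce to sets of finite outer measure, where [preimage_fin]
    applies. *)
Lemma bilipschitz_measurable : measurable_fun setT (D : L -> L).
Proof.
move=> _ E mE; rewrite setTI.
pose Q (N : nat) : set V := box (const_mx (- N%:R)) (const_mx N%:R).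
have -> : E = \bigcup_N (E `&` Q N).
  rewrite -setI_bigcupr; apply/esym/setIidPl => x _.
  exists (Num.truncn `|x|).+1 => // i; rewrite !mxE.
  have := le_lt_trans (mx_norm_coord R _ x i) (truncnS_gt `|x|).
  by rewrite ltr_norml => /andP[-> /ltW].
rewrite preimage_bigcup; apply: bigcupT_measurable => N.
apply: preimage_fin.
  by apply: measurableI => //; exact: box_measurable.
by apply: lebesgue_outer_box_fin; exact: subIsetr.
Qed.

(** The pushforward of Lebesgue measure by [D] is at most a constant times Lebesgue measure, and
    integrals of nonnegative functions are monotone in the measure. This inequality takes the place
    of the change of variables formula. *)
Lemma ge0_integral_bilipschitz (g : L -> \bar R) :
  measurable_fun [set: L] g -> (forall x, 0 <= g x)%E ->
  (\int[lebesgue_rV R n]_x g (D x) <=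
   ((6 * K) ^+ n.+1)%:E * \int[lebesgue_rV R n]_x g x)%E.
Proof.
move=> mg g0.
have C0 : 0 <= (6 * K) ^+ n.+1 by rewrite exprn_ge0// mulr_ge0// ltW.
have mD := bilipschitz_measurable.
rewrite -[leLHS](ge0_integral_pushforward mD (lebesgue_rV R n) (D := setT) (f := g))//.
rewrite -[leRHS](ge0_integral_mscale (lebesgue_rV R n) measurableT (NngNum C0))//.
apply: ge0_le_measure_integral => // S mS.
exact: preimage_outer.
Qed.

End bilipschitz.

(** * Convergence of L^q norms *)

Lemma powR_invr_cvg1 (R : realType) (c : R) :
  0 < c -> (c `^ q^-1) @[q --> +oo%R] --> (1 : R).
Proof.
move=> c0.
have -> : (fun q : R => c `^ q^-1) = (fun q => expR (q^-1 * ln c)).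
  by apply/funext => q; rewrite /powR gt_eqF.
rewrite -expR0; apply: continuous_cvg; first exact: continuous_expR.
rewrite -[X in _ --> X](mul0r (ln c)); apply: cvgMl.
by apply/gtr0_cvgV0; [exact: nbhs_pinfty_gt|exact: cvg_id].
Qed.

Section Lnorm_limit.
Context d (T : measurableType d) (R : realType).
Variables (mu : {measure set T -> \bar R}) (D : set T) (g : T -> R) (M : R).
Hypotheses (mD : measurable D) (muD : (mu D < +oo)%E).
Hypothesis mg : measurable_fun [set: T] g.
Hypothesis gD : forall x, ~ D x -> g x = 0.
Hypothesis gM : forall x, `|g x| <= M.

Let N p := Lnorm mu p (EFin \o g).
Let S := fine (N +oo%E).
Let delta := fine (mu D).

Let muD_fin : mu D \is a fin_num. Proof. by rewrite ge0_fin_numE. Qed.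

Let M0 : 0 <= M. Proof. exact: le_trans (normr_ge0 _) (gM point). Qed.

Let Noo_le : (N +oo%E <= M%:E)%E.
Proof.
(* The norm for exponent +oo is the essential supremum only if the whole space has positive measure;
   otherwise it is 0 by convention. *)
rewrite /N unlock; case: ifPn => _; last by rewrite lee_fin.
by apply/ess_supP; apply: nearW => x /=; rewrite lee_fin.
Qed.

Let Noo_fin : N +oo%E \is a fin_num.
Proof. by rewrite ge0_fin_numE ?Lnorm_ge0//; exact: le_lt_trans Noo_le (ltry _). Qed.

Let S0 : 0 <= S. Proof. by apply: fine_ge0; exact: Lnorm_ge0. Qed.

Let ae_S : {ae mu, forall x, `|g x| <= S}.
Proof.
suff : {ae mu, forall x, (`|(g x)%:E| <= N +oo%E)%E}.
  by apply: filterS => x; rewrite -(fineK Noo_fin) -/S abse_EFin lee_fin.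
rewrite /N unlock; case: ifPn => [_|]; first exact: ess_sup_ge.
rewrite -leNgt => muT0; exists setT; split => //.
by apply/eqP; rewrite eq_le muT0 measure_ge0.
Qed.

Let measurable_powR_norm q : measurable_fun [set: T] (fun x => (`|g x| `^ q)%:E).
Proof.
apply/measurable_EFinP.
apply: (@measurableT_comp _ _ _ _ _ _ (fun x : R => x `^ q)) => //=.
exact: measurableT_comp.
Qed.

Let integral_le q : 0 < q ->
  (\int[mu]_x (`|g x| `^ q)%:E <= (S `^ q * delta)%:E)%E.
Proof.
move=> q0.
have -> : (\int[mu]_x (`|g x| `^ q)%:E = \int[mu]_(x in D) (`|g x| `^ q)%:E)%E.
  rewrite [RHS]integral_mkcond; apply: eq_integral => x _; rewrite patchE.
  case: ifPn => // /negP xD; rewrite gD ?normr0 ?powR0 ?gt_eqF// => Dx.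
  by apply: xD; rewrite inE.
rewrite EFinM /delta fineK// -integral_cst//.
apply: ae_ge0_le_integral => //.
- exact: measurable_funTS.
- by move=> x _; rewrite lee_fin powR_ge0.
- apply: filterS ae_S => x gS _; rewrite lee_fin.
  by apply: ge0_ler_powR => //; rewrite ?nnegrE//; exact: ltW.
Qed.

Let NE q : N q%:E = ((\int[mu]_x (`|g x| `^ q)%:E) `^ q^-1)%E.
Proof. by rewrite /N unlock. Qed.

Let Nq_le q : 0 < q -> (N q%:E <= (S * delta `^ q^-1)%:E)%E.
Proof.
move=> q0; rewrite NE.
have d0 : 0 <= delta by exact: fine_ge0.
have -> : (S * delta `^ q^-1)%:E = ((S `^ q * delta)%:E `^ q^-1)%E.
  rewrite poweR_EFin powRM ?powR_ge0// -powRrM mulfV ?gt_eqF// powRr1//.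
have I0 : (0 <= \int[mu]_x (`|g x| `^ q)%:E)%E.
  by apply: integral_ge0 => x _; rewrite lee_fin powR_ge0.
apply: gt0_ler_poweR; rewrite ?in_itv/= ?I0 ?leey ?andbT//.
- by rewrite invr_ge0 ltW.
- by rewrite lee_fin mulr_ge0 ?powR_ge0.
- exact: integral_le.
Qed.

Lemma bounded_Lfun p : (1 <= p)%E -> g \in Lfun mu p.
Proof.
move=> p1; rewrite inE; apply/andP; split; rewrite inE//= /finite_norm -/(N p).
case: p p1 => [q|_|//]; last by rewrite -ge0_fin_numE// Lnorm_ge0.
rewrite lee_fin => q1.
by apply: le_lt_trans (ltry _); apply: Nq_le; exact: lt_le_trans q1.
Qed.

(** Markov's inequality on [E]. Its measure is positive because [l] lies below the essential
    supremum, finite because [l >= 0] forces [E] into [D], and independent of [q]. *)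
Let Nq_ge l : 0 <= l -> l < S -> exists2 e : R, 0 < e &
  forall q, 0 < q -> ((l * e `^ q^-1)%:E <= N q%:E)%E.
Proof.
move=> l0 lS; pose E := [set x | l < `|g x|].
have mE : measurable E.
  have := measurableT_comp (@normr_measurable R setT) mg.
  by move=> /(_ measurableT `]l, +oo[%classic (measurable_itv _)); rewrite setTI preimage_itvoy.
have ED : E `<=` D.
  move=> x; rewrite /E/=; apply: contraPP => /gD ->; rewrite normr0.
  by apply/negP; rewrite -leNgt.
have Efin : mu E \is a fin_num.
  by rewrite ge0_fin_numE//; apply: le_lt_trans muD; rewrite le_measure ?inE.
have Egt0 : (0 < mu E)%E.
  rewrite lt0e measure_ge0 andbT; apply/eqP => E0.
  have : (N +oo%E <= l%:E)%E.
    rewrite /N unlock; case: ifPn => _; last by rewrite lee_fin.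
    apply/ess_supP; exists E; split=> // x /=; rewrite lee_fin => /negP.
    by rewrite -ltNge.
  by rewrite -(fineK Noo_fin) lee_fin leNgt lS.
exists (fine (mu E)) => [|q q0]; first by rewrite fine_gt0// Egt0 -ge0_fin_numE.
rewrite NE.
have -> : (l * fine (mu E) `^ q^-1)%:E = ((l `^ q * fine (mu E))%:E `^ q^-1)%E.
  rewrite poweR_EFin powRM ?powR_ge0 ?fine_ge0// -powRrM mulfV ?gt_eqF// powRr1//.
have I0 : (0 <= \int[mu]_x (`|g x| `^ q)%:E)%E.
  by apply: integral_ge0 => x _; rewrite lee_fin powR_ge0.
apply: gt0_ler_poweR; rewrite ?in_itv/= ?I0 ?leey ?andbT//; first by rewrite invr_ge0 ltW.
  by rewrite lee_fin mulr_ge0 ?powR_ge0 ?fine_ge0.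
rewrite EFinM fineK// -integral_cst//.
apply: (@le_trans _ _ (\int[mu]_(x in E) (`|g x| `^ q)%:E)%E).
  apply: ge0_le_integral => //.
  - by move=> x _; rewrite lee_fin powR_ge0.
  - exact: measurable_funTS.
  - move=> x lx; rewrite lee_fin.
    by apply: ge0_ler_powR => //; rewrite ?nnegrE//; exact: ltW.
by apply: ge0_subset_integral => // x _; rewrite lee_fin powR_ge0.
Qed.

Lemma Lnorm_cvg_Loo : N q%:E @[q --> +oo] --> N +oo%E.
Proof.
have N_fin q : 0 < q -> N q%:E \is a fin_num.
  move=> q0; rewrite ge0_fin_numE ?Lnorm_ge0//.
  exact: le_lt_trans (Nq_le q q0) (ltry _).
rewrite -(fineK Noo_fin) -/S; apply/fine_cvgP; split.
  by apply: filterS (nbhs_pinfty_gt (num_real 0)) => q; exact: N_fin.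
have ub e : 0 < e -> \forall q \near +oo, fine (N q%:E) < S + e.
  (* [delta] may vanish, and then its powers do not tend to 1; [delta + 1] is a positive upper
     bound. *)
  move=> e0; have d1 : 0 < delta + 1 by rewrite ltr_wpDl ?fine_ge0.
  have : S * (delta + 1) `^ q^-1 @[q --> +oo] --> S * 1.
    by apply: cvgMr; exact: powR_invr_cvg1.
  rewrite mulr1 => /cvgrPdist_lt /(_ e e0) H.
  near=> q; have q0 : 0 < q by near: q; exact: nbhs_pinfty_gt.
  have : `|S - S * (delta + 1) `^ q^-1| < e by near: q.
  rewrite ltr_norml => /andP[? _].
  apply: (@le_lt_trans _ _ (S * (delta + 1) `^ q^-1)); last lra.
  rewrite -lee_fin fineK ?N_fin//; apply: le_trans (Nq_le q q0) _.
  rewrite lee_fin ler_wpM2l//; apply: ge0_ler_powR; rewrite ?nnegrE ?fine_ge0//.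
  - by rewrite invr_ge0 ltW.
  - exact: ltW.
  - by rewrite /delta lerDl.
have lb e : 0 < e -> \forall q \near +oo, S - e < fine (N q%:E).
  (* [Nq_ge] needs a nonnegative level below [S]. If [S - e] is nonnegative, so is [S - e / 2], and
     the other half of [e] pays for the convergence of the powers of [c]. *)
  move=> e0; have [Se|eS] := ltP (S - e) 0.
    by near=> q; apply: lt_le_trans Se _; apply: fine_ge0; exact: Lnorm_ge0.
  have [||c c0 Nc] := Nq_ge (S - e / 2); [lra|lra|].
  have : (S - e / 2) * c `^ q^-1 @[q --> +oo] --> (S - e / 2) * 1.
    by apply: cvgMr; exact: powR_invr_cvg1.
  rewrite mulr1 => /cvgrPdist_lt /(_ (e / 2)) H.
  near=> q; have q0 : 0 < q by near: q; exact: nbhs_pinfty_gt.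
  have : `|S - e / 2 - (S - e / 2) * c `^ q^-1| < e / 2.
    by near: q; apply: H; rewrite divr_gt0.
  rewrite ltr_norml => /andP[_ ?].
  apply: (@lt_le_trans _ _ ((S - e / 2) * c `^ q^-1)); first lra.
  by rewrite -lee_fin fineK ?N_fin//; exact: Nc.
apply/cvgrPdist_lt => e e0; near=> q; rewrite ltr_norml; apply/andP; split.
  have : fine (N q%:E) < S + e by near: q; exact: ub.
  rewrite /=; lra.
have : S - e < fine (N q%:E) by near: q; exact: lb.
rewrite /=; lra.
Unshelve. all: by end_near. Qed.

End Lnorm_limit.

(** * One-sided derivatives and Gronwall's inequality *)

Section deriv_within.
Context {R : realType}.

(** The expansion form has no quotient and includes [u = t], so it passes easily to coordinates,
    differences and interior points. *)
Lemma deriv_withinP (V : normedModType R) (D : set R) (s : R -> V) (t : R) (l : V) :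
  deriv_within D s t l <->
  forall e, 0 < e -> \forall u \near t, D u ->
    `|s u - s t - (u - t) *: l| <= e * `|u - t|.
Proof.
have quotE u : u != t ->
    `|l - (u - t)^-1 *: (s u - s t)| = `|u - t|^-1 * `|s u - s t - (u - t) *: l|.
  rewrite -subr_eq0 => ut; rewrite -normfV -normrZ [in RHS]scalerBr scalerA mulVf// scale1r.
  exact: distrC.
split=> [/cvgrPdist_le sl e e0|sl].
  have := sl e e0; rewrite near_withinE near_withinE.
  apply: filterS => u H Du; have [->|ut] := eqVneq u t.
    by rewrite !subrr scale0r subrr !normr0 mulr0.
  by have := H ut Du; rewrite quotE// mulrC ler_pdivrMr// normr_gt0 subr_eq0.
apply/cvgrPdist_le => e e0; rewrite near_withinE near_withinE.
apply: filterS (sl e e0) => u H ut Du.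
by rewrite quotE// mulrC ler_pdivrMr ?H// normr_gt0 subr_eq0.
Qed.

Lemma near_shift0 (P : R -> Prop) (t : R) :
  (\forall h \near (0 : R), P (h + t)) <-> \forall u \near t, P u.
Proof.
split=> /nbhs_ballP[d /= d0 dP]; apply/nbhs_ballP; exists d => //= u.
  rewrite -[in P u](subrK t u) => tu; apply: dP; move: tu.
  by rewrite /ball/= sub0r opprB.
by rewrite /ball/= sub0r normrN => ud; apply: dP; rewrite /ball/= opprD addrCA subrr addr0 normrN.
Qed.

Lemma is_derive1P (f : R -> R) (t l : R) :
  is_derive t 1 f l <->
  forall e, 0 < e -> \forall u \near t, `|f u - f t - (u - t) * l| <= e * `|u - t|.
Proof.
have quotE (h : R) : h != 0 ->
    `|l - h^-1 *: (f (h *: 1 + t) - f t)| = `|h|^-1 * `|f (h + t) - f t - (h + t - t) * l|.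
  move=> h0; rewrite -normfV -normrM mulrBr addrK mulrA mulVf// mul1r.
  by rewrite /GRing.scale/= mulr1 distrC.
have key : (h^-1 *: (f (h *: 1 + t) - f t) @[h --> 0^'] --> l) <->
    forall e, 0 < e -> \forall u \near t, `|f u - f t - (u - t) * l| <= e * `|u - t|.
  split=> [/cvgrPdist_le fl e e0|fl].
    apply/near_shift0; have := fl e e0; rewrite near_withinE.
    apply: filterS => h H; have [->|h0] := eqVneq h 0.
      by rewrite add0r !subrr mul0r subrr !normr0 mulr0.
    have := H h0; rewrite quotE// mulrC ler_pdivrMr ?normr_gt0//.
    by rewrite [in X in _ -> _ <= X]addrK.
  apply/cvgrPdist_le => e e0; rewrite near_withinE.
  move/near_shift0 : (fl e e0); apply: filterS => h H h0.
  by rewrite quotE// mulrC ler_pdivrMr ?normr_gt0//; move: H; rewrite [in X in _ <= X -> _]addrK.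
rewrite -key; split=> [[df <-]|fl]; first exact: df.
by split; [apply/cvg_ex; exists l|exact: cvg_lim fl].
Qed.

Lemma deriv_within_coord (n : nat) (D : set R) (s : R -> 'rV[R]_n.+1) t (l : 'rV[R]_n.+1) i :
  deriv_within D s t l -> deriv_within D (fun u => s u 0 i : R) t (l 0 i).
Proof.
move=> /deriv_withinP sl; apply/deriv_withinP => e e0.
apply: filterS (sl e e0) => u H Du; apply: le_trans (H Du).
by have := mx_norm_coord R _ (s u - s t - (u - t) *: l) i; rewrite !mxE.
Qed.

Lemma coord_deriv_within (n : nat) (D : set R) (s : R -> 'rV[R]_n.+1) t (l : 'rV[R]_n.+1) :
  (forall i, deriv_within D (fun u => s u 0 i : R) t (l 0 i)) -> deriv_within D s t l.
Proof.
move=> sl; apply/deriv_withinP => e e0.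
have sle i : \forall u \near t, D u ->
    `|s u 0 i - s t 0 i - (u - t) *: l 0 i| <= e * `|u - t|.
  by have /deriv_withinP /(_ e e0) := sl i.
apply: filterS (@filter_forall _ _ _ _ (nbhs_filter t) sle) => u H Du; apply: mx_norm_le_coord => [|i].
  by rewrite mulr_ge0// ltW.
by rewrite !mxE; exact: H.
Qed.

Lemma is_derive_within (D : set R) (f : R -> R) (t l : R) :
  is_derive t 1 f l -> deriv_within D f t l.
Proof.
move=> /is_derive1P fl; apply/deriv_withinP => e e0.
by apply: filterS (fl e e0).
Qed.

Lemma deriv_within_is_derive (a b : R) (f : R -> R) (t l : R) : a < t < b ->
  deriv_within `[a, b] f t l -> is_derive t 1 f l.
Proof.
move=> atb /deriv_withinP fl; apply/is_derive1P => e e0.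
have tab : \forall u \near t, u \in `]a, b[ by apply: near_in_itvoo; rewrite in_itv.
near=> u; have uab : u \in `]a, b[ by near: u.
have : `[a, b]%classic u -> `|f u - f t - (u - t) *: l| <= e * `|u - t| by near: u; exact: fl.
by apply; apply: subset_itv_oo_cc uab.
Unshelve. all: by end_near. Qed.

Lemma deriv_withinB (V : normedModType R) (D : set R) (f g : R -> V) (t : R) (k l : V) :
  deriv_within D f t k -> deriv_within D g t l ->
  deriv_within D (fun u => f u - g u) t (k - l).
Proof.
move=> /deriv_withinP fk /deriv_withinP gl; apply/deriv_withinP => e e0.
near=> u => Du.
have fu : D u -> `|f u - f t - (u - t) *: k| <= e / 2 * `|u - t|.
  by near: u; apply: fk; rewrite divr_gt0.
have gu : D u -> `|g u - g t - (u - t) *: l| <= e / 2 * `|u - t|.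
  by near: u; apply: gl; rewrite divr_gt0.
have -> : f u - g u - (f t - g t) - (u - t) *: (k - l) =
    (f u - f t - (u - t) *: k) - (g u - g t - (u - t) *: l).
  have subrACA (x y z w : V) : x - y - (z - w) = x - z - (y - w).
    by rewrite opprD addrACA -opprD.
  by rewrite scalerBr (subrACA (f u)) (subrACA (f u - f t)).
apply: le_trans (ler_normB _ _) _.
rewrite (splitr e) mulrDl; apply: lerD; [exact: fu|exact: gu].
Unshelve. all: by end_near. Qed.

Lemma deriv_within_continuous (a b : R) (f df : R -> R) :
  (forall t, t \in `[a, b] -> deriv_within `[a, b] f t (df t)) ->
  {within `[a, b], continuous f}.
Proof.
move=> fdf; apply/subspace_continuousP => t tab.
have /deriv_withinP fl := fdf t tab.
apply/cvgrPdist_le => e e0; rewrite near_withinE.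
have c0 : 0 < 1 + `|df t| by rewrite ltr_wpDr.
have tn : \forall u \near t, `|t - u| <= e / (1 + `|df t|).
  have := nbhsx_ballx t (e / (1 + `|df t|)) (divr_gt0 e0 c0).
  by apply: filterS => u /ltW.
near=> u => uab.
have fu : `[a, b]%classic u -> `|f u - f t - (u - t) *: df t| <= 1 * `|u - t|.
  by near: u; exact: fl.
have : `|t - u| <= e / (1 + `|df t|) by near: u.
rewrite ler_pdivlMr// => tue.
have -> : f t - f u = - ((f u - f t - (u - t) *: df t) + (u - t) *: df t).
  by rewrite subrK opprB.
rewrite normrN; apply: le_trans (ler_normD _ _) _.
apply: le_trans (lerD (fu uab) (lexx _)) _.
by rewrite normrZ (distrC u t); lra.
Unshelve. all: by end_near. Qed.

(** Mean value theorem; derivatives are two-sided in the open interval only, and continuity takes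
    care of the end points. *)
Lemma within_ger0_ndecr (a b : R) (f df : R -> R) :
  {within `[a, b], continuous f} ->
  (forall t : R, a < t < b -> is_derive t 1 f (df t)) ->
  (forall t : R, a < t < b -> 0 <= df t) ->
  forall x y, a <= x -> x <= y -> y <= b -> f x <= f y.
Proof.
move=> cf fdf df0 x y ax xy yb.
move: xy; rewrite le_eqVlt => /predU1P[->//|xy].
have [t||t] := @MVT R f df x y xy.
- rewrite in_itv/= => /andP[xt ty]; apply: fdf.
  by rewrite (le_lt_trans ax)// (lt_le_trans ty).
- apply: continuous_subspaceW cf => t /=; rewrite !in_itv/= => /andP[xt ty].
  by rewrite (le_trans ax)// (le_trans ty).
rewrite in_itv/= => /andP[xt ty] fE; rewrite -subr_ge0 fE.
apply: mulr_ge0; last by rewrite subr_ge0 ltW.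
by apply: df0; rewrite (le_lt_trans ax)// (lt_le_trans ty).
Qed.

Lemma deriv_within_ndecr (a b : R) (f df : R -> R) :
  (forall t, t \in `[a, b] -> deriv_within `[a, b] f t (df t)) ->
  (forall t, t \in `[a, b] -> 0 <= df t) ->
  forall x y, a <= x -> x <= y -> y <= b -> f x <= f y.
Proof.
move=> fdf df0; apply: (@within_ger0_ndecr a b f df).
- exact: deriv_within_continuous fdf.
- move=> t tab; apply: deriv_within_is_derive (tab) _; apply: fdf.
  by rewrite in_itv/=; move/andP : tab => [/ltW -> /ltW ->].
- move=> t tab; apply: df0.
  by rewrite in_itv/=; move/andP : tab => [/ltW -> /ltW ->].
Qed.

(** Both [f] and [0 - f] are nondecreasing. *)
Lemma deriv_within0_cst (a b : R) (f : R -> R) :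
  (forall t, t \in `[a, b] -> deriv_within `[a, b] f t (0 : R)) ->
  forall x y, x \in `[a, b] -> y \in `[a, b] -> f x = f y.
Proof.
move=> f0.
have Nf0 t : t \in `[a, b] -> deriv_within `[a, b] (fun u => 0 - f u) t (0 : R).
  move=> tab; rewrite -[X in deriv_within _ _ _ X]subr0; apply: deriv_withinB (f0 t tab).
  by apply: is_derive_within; exact: is_derive_cst.
have le x y : x \in `[a, b] -> y \in `[a, b] -> x <= y -> f x = f y.
  rewrite !in_itv/= => /andP[ax xb] /andP[ay yb] xy; apply/eqP; rewrite eq_le.
  rewrite (@deriv_within_ndecr a b f (fun=> 0))//=.
  by have := @deriv_within_ndecr a b _ (fun=> 0) Nf0 (fun _ _ => lexx _) x y ax xy yb; lra.
move=> x y xab yab; have [xy|/ltW yx] := leP x y; first exact: le.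
by apply/esym; exact: le.
Qed.

(** Both [g - f] and [g + f] are nondecreasing. This mean value inequality serves wherever the norm
    of an integral would be bounded by the integral of the norm. *)
Lemma deriv_within_le_abs (a b : R) (f df g dg : R -> R) :
  (forall t, t \in `[a, b] -> deriv_within `[a, b] f t (df t)) ->
  (forall t : R, is_derive t 1 g (dg t)) ->
  (forall t, t \in `[a, b] -> `|df t| <= dg t) ->
  forall x y, x \in `[a, b] -> y \in `[a, b] -> `|f y - f x| <= `|g y - g x|.
Proof.
move=> fdf gdg dfg.
have gw t : deriv_within `[a, b] g t (dg t) by apply: is_derive_within.
have fgdf t : t \in `[a, b] -> deriv_within `[a, b] (fun u => g u - f u) t (dg t - df t).
  by move=> tab; apply: deriv_withinB => //; exact: fdf.
have gNfdf t : t \in `[a, b] ->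
    deriv_within `[a, b] (fun u => g u - (0 - f u)) t (dg t - (0 - df t)).
  move=> tab; apply: deriv_withinB => //; apply: deriv_withinB; last exact: fdf.
  by apply: is_derive_within; exact: is_derive_cst.
have le x y : x \in `[a, b] -> y \in `[a, b] -> x <= y -> `|f y - f x| <= g y - g x.
  rewrite !in_itv/= => /andP[ax xb] /andP[ay yb] xy.
  have h1 : g x - f x <= g y - f y.
    apply: (@deriv_within_ndecr a b _ _ fgdf) => // t tab.
    by have := dfg t tab; rewrite ler_norml => /andP[_]; rewrite subr_ge0.
  have h2 : g x - (0 - f x) <= g y - (0 - f y).
    apply: (@deriv_within_ndecr a b _ _ gNfdf) => // t tab.
    by have := dfg t tab; rewrite ler_norml => /andP[? _]; lra.
  by rewrite ler_norml; apply/andP; split; lra.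
move=> x y xab yab; have [xy|/ltW yx] := leP x y.
  by apply: le_trans (ler_norm _); exact: le.
by rewrite distrC (distrC (g y)); apply: le_trans (ler_norm _); exact: le.
Qed.

(** [v (- c)] is nonincreasing and [v c] nondecreasing: the first gives the bound forward in time,
    the second backward. Both directions are needed because flow maps run either way. *)
Lemma gronwall (a b c : R) (u du : R -> R) :
  {within `[a, b], continuous u} ->
  (forall t : R, a < t < b -> is_derive t 1 u (du t)) ->
  (forall t : R, a < t < b -> `|du t| <= c * u t) ->
  forall x y, x \in `[a, b] -> y \in `[a, b] -> u y <= u x * expR (c * `|y - x|).
Proof.
move=> cu udu duc.
pose v k t := u t * expR (k * t).
have cexp k : continuous (fun t : R => expR (k * t)).
  move=> t; apply: continuous_comp; last exact: continuous_expR.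
  by apply: cvgMr; exact: cvg_id.
have cv k : {within `[a, b], continuous (v k)}.
  move=> t; apply: cvgM; first exact: cu.
  by apply: (continuous_subspaceT (cexp k)).
have dexp (k t : R) : is_derive t 1 (fun t : R => expR (k * t)) (k * expR (k * t)).
  apply: is_derive_eq; rewrite /GRing.scale/=; ring.
have dv k t : a < t < b -> is_derive t 1 (v k) ((du t + k * u t) * expR (k * t)).
  move=> tab; have := udu t tab => ?; apply: is_derive_eq.
  rewrite /GRing.scale/=; ring.
move=> x y; rewrite !in_itv/= => /andP[ax xb] /andP[ay yb].
have [xy|/ltW yx] := leP x y.
  have : - v (- c) x <= - v (- c) y.
    apply: (@within_ger0_ndecr a b (fun t => - v (- c) t)
        (fun t => - ((du t - c * u t) * expR (- c * t)))) => //.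
    - by move=> t; apply: cvgN; exact: cv.
    - move=> t tab; have := dv (- c) t tab => ?; apply: is_derive_eq.
      by rewrite mulNr.
    - move=> t tab; have := duc t tab; rewrite ler_norml => /andP[_ ?].
      by rewrite oppr_ge0 mulr_le0_ge0 ?expR_ge0// subr_le0.
  rewrite lerN2 /v => le.
  rewrite ger0_norm ?subr_ge0// -(ler_pM2r (expR_gt0 (- c * y))).
  by rewrite -mulrA -expRD (_ : _ + _ = - c * x)//; ring.
have : v c y <= v c x.
  apply: (@within_ger0_ndecr a b (v c) (fun t => (du t + c * u t) * expR (c * t))) => //.
  move=> t tab; have := duc t tab; rewrite ler_norml => /andP[? _].
  by rewrite mulr_ge0 ?expR_ge0//; lra.
rewrite /v => le.
rewrite ler0_norm ?subr_le0// -(ler_pM2r (expR_gt0 (c * y))).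
by rewrite -mulrA -expRD (_ : _ + _ = c * x)//; ring.
Qed.

End deriv_within.

(** * Existence and regularity of the flow *)

Section velocity_lipschitz.
Context {R : realType} {n : nat}.
Local Notation V := 'rV[R]_n.+1.

Lemma entry_le_op_norm (M : 'M[R]_n.+1) i j : `|M i j| <= op_norm M.
Proof.
have coord_le (v : 'cV[R]_n.+1) k : `|v k 0| <= euclid_norm v.
  rewrite /euclid_norm -(sqrtr_sqr (v k 0)) ler_wsqrtr//.
  by rewrite (bigD1 k)//= lerDl sumr_ge0// => l _; exact: sqr_ge0.
have col_le : euclid_norm (delta_mx j 0) <= 1 :> R.
  rewrite /euclid_norm (bigD1 j)//= big1 => [|k kj]; last first.
    by rewrite mxE (negbTE kj) expr0n.
  by rewrite mxE !eqxx addr0 expr1n sqrtr1.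
apply: (@le_trans _ _ (euclid_norm (M *m delta_mx j 0))).
  by apply: le_trans (coord_le _ i); rewrite -colE mxE.
apply: ub_le_sup; last by exists (delta_mx j 0).
(* [sup] dominates the elements only of a set known to be bounded; this bound holds since all
   entries of [v] have modulus at most 1. *)
exists (Num.sqrt (\sum_k (\sum_l `|M k l|) ^+ 2)) => _ [v /= v1 <-].
rewrite /euclid_norm ler_wsqrtr//; apply: ler_sum => k _.
rewrite -(real_normK (num_real _)) ler_sqr ?nnegrE ?sumr_ge0//.
rewrite mxE; apply: le_trans (ler_norm_sum _ _ _) _; apply: ler_sum => l _.
by rewrite normrM ler_piMr// (le_trans (coord_le _ _)).
Qed.

Variables (T : R) (A : V -> R -> V) (LA : R).
Hypothesis A_C1 : C1_velocity T A.
Hypothesis jac_le : forall x t, t \in `[0, T] -> op_norm (spatial_jacobian A t x) <= LA.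

Lemma velocity_line_lipschitz t (i j : 'I_n.+1) (z : V) (r : R) : t \in `[0, T] ->
  `|A (z + r *: delta_mx 0 j) t 0 i - A z t 0 i| <= LA * `|r|.
Proof.
move=> tT; pose f r := A (z + r *: delta_mx 0 j) t 0 i.
pose df r := partial_x j A t (z + r *: delta_mx 0 j) 0 i.
have fdf r' : is_derive r' (1 : R) (f : R -> R) (df r').
  have [_ /(_ j)[/(_ (z + r' *: delta_mx 0 j) t tT) dA _] _] := A_C1.
  have dAE : h^-1 *: (A (h *: delta_mx 0 j + (z + r' *: delta_mx 0 j)) t -
      A (z + r' *: delta_mx 0 j) t) @[h --> 0^'] --> partial_x j A t (z + r' *: delta_mx 0 j).
    exact: dA.
  have fE : h^-1 *: (f (h *: 1 + r') - f r') @[h --> 0^'] --> df r'.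
    have := cvg_comp _ _ dAE (@coord_continuous R 1 n.+1 0 i (partial_x j A t (z + r' *: delta_mx 0 j))).
    apply: cvg_trans; apply: near_eq_cvg; near=> h.
    rewrite /= !mxE /f [h *: 1]mulr1 scalerDl.
    by rewrite addrCA.
  by split; [apply/cvg_ex; exists (df r')|exact: cvg_lim fE].
have df_le r' : `|df r'| <= LA.
  apply: le_trans (jac_le (z + r' *: delta_mx 0 j) t tT).
  by apply: le_trans (entry_le_op_norm _ i j); rewrite mxE.
have gdg s : is_derive s (1 : R) (fun u : R => LA * u) LA.
  by apply: is_derive_eq; rewrite /GRing.scale/= mulr1.
have LA0 : 0 <= LA by apply: le_trans (df_le 0).
(* A symmetric interval contains both 0 and [r], whatever the sign of [r]. *)
have rr : r \in `[- `|r|, `|r|] by rewrite in_itv/= ler_norm andbT lerNl -normrN ler_norm.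
have r0 : 0 \in `[- `|r|, `|r|] by rewrite in_itv/= normr_ge0 oppr_le0 normr_ge0.
have := @deriv_within_le_abs R (- `|r|) `|r| f df (fun u : R => LA * u) (fun=> LA)
  (fun s _ => is_derive_within _ _ _ _ (fdf s)) gdg (fun s _ => df_le s) 0 r r0 rr.
by rewrite /f scale0r addr0 mulr0 subr0 normrM (ger0_norm LA0).
Unshelve. all: by end_near. Qed.

(** Only partial derivatives are at hand, so [y] is turned into [x] one coordinate at a time: [p k]
    takes the first [k] coordinates from [x]. Each of the [n.+1] changes costs at most [LA] times
    the max-norm distance. *)
Lemma velocity_lipschitz t x y : t \in `[0, T] ->
  `|A x t - A y t| <= n.+1%:R * LA * `|x - y|.
Proof.
move=> tT; pose p k : V := \row_j (if (j < k)%N then x 0 j else y 0 j).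
have LA0 : 0 <= LA.
  by apply: le_trans (jac_le 0 t tT); apply: le_trans (entry_le_op_norm _ 0 0).
have step k i : (k <= n.+1)%N -> `|A (p k) t 0 i - A y t 0 i| <= k%:R * LA * `|x - y|.
  elim: k => [|k ih] kn.
    have -> : p 0%N = y by apply/rowP => j; rewrite mxE.
    by rewrite subrr normr0 !mul0r.
  have pk : p k.+1 = p k + (x 0 (Ordinal kn) - y 0 (Ordinal kn)) *: delta_mx 0 (Ordinal kn).
    apply/rowP => j; rewrite !mxE/= -(inj_eq val_inj)/= ltnS leq_eqVlt.
    have [jk|_] := eqVneq (val j) k; last by rewrite mulr0 addr0.
    have -> : j = Ordinal kn by exact: val_inj.
    by rewrite /= ltnn mulr1 addrCA subrr addr0.
  rewrite (_ : _ - _ = (A (p k.+1) t 0 i - A (p k) t 0 i) + (A (p k) t 0 i - A y t 0 i));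
    last by rewrite addrA subrK.
  apply: le_trans (ler_normD _ _) _; rewrite -natr1 !mulrDl mul1r addrC.
  apply: lerD; first exact/ih/ltnW.
  rewrite pk; apply: le_trans (velocity_line_lipschitz _ _ _ _ _ tT) _.
  rewrite ler_wpM2l//; have := mx_norm_coord R _ (x - y) (Ordinal kn).
  by rewrite !mxE.
apply: mx_norm_le_coord => [|i]; first by rewrite !mulr_ge0.
have := step n.+1 i (leqnn _); rewrite !mxE.
by have -> : p n.+1 = x by apply/rowP => j; rewrite mxE ltn_ord.
Qed.

End velocity_lipschitz.

Lemma geometric_limit (R : realType) (n : nat) (s : nat -> 'rV[R]_n) (B : R) :
  (forall k, `|s k.+1 - s k| <= B * 2^-1 ^+ k) ->
  exists l, forall k, `|l - s k| <= 2 * B * 2^-1 ^+ k.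
Proof.
move=> sB.
have B0 : 0 <= B by have := le_trans (normr_ge0 _) (sB 0%N); rewrite expr0 mulr1.
have h0 k : 0 <= (2^-1 : R) ^+ k by rewrite exprn_ge0.
have tail k j : `|s (k + j)%N - s k| <= 2 * B * 2^-1 ^+ k.
  (* The induction on [j] carries the exact partial sum of the geometric series. *)
  apply: (@le_trans _ _ (2 * B * 2^-1 ^+ k * (1 - 2^-1 ^+ j))); last first.
    by rewrite ler_piMr ?mulr_ge0// lerBlDr lerDl.
  elim: j => [|j ih]; first by rewrite addn0 subrr normr0 expr0 subrr mulr0.
  rewrite addnS (_ : _ - _ = (s (k + j).+1 - s (k + j)%N) + (s (k + j)%N - s k)); last first.
    by rewrite addrA subrK.
  apply: le_trans (ler_normD _ _) _; apply: le_trans (lerD (sB _) ih) _.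
  by rewrite exprD exprS le_eqVlt; apply/orP; left; apply/eqP; field.
have small e : 0 < e -> exists k, 2 * B * 2^-1 ^+ k < e.
  move=> e0; have : (fun k => 2 * B * 2^-1 ^+ k) @ \oo --> 2 * B * 0.
    by apply: cvgMr; apply: cvg_expr; rewrite ger0_norm// invf_lt1// ltr1n.
  rewrite mulr0 => /cvgrPdist_lt /(_ e e0) [k _ /(_ k (leqnn k))].
  by rewrite sub0r normrN ger0_norm ?mulr_ge0// => ?; exists k.
have cs : cvgn s.
  apply/cauchy_cvgP/cauchy_ballP => e e0; near_simpl.
  have [k ke] := small (e / 2) (divr_gt0 e0 (ltr0n _ 2)).
  have nk : \forall i \near \oo, `|s i - s k| < e / 2.
    exists k => // i /= ki; apply: le_lt_trans ke.
    by rewrite -(subnKC ki); exact: tail.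
  near=> i j; rewrite -ball_normE /ball_/=.
  have -> : s i - s j = (s i - s k) - (s j - s k).
    by rewrite opprB addrA subrK.
  apply: le_lt_trans (ler_normB _ _) _; rewrite (splitr e); apply: ltrD.
    by near: i.
  by near: j.
exists (limn s) => k.
apply/ler_addgt0Pr => e e0.
have /cvgrPdist_lt /(_ e e0) [j _ js] := cs.
have -> : limn s - s k = (limn s - s (k + j)%N) + (s (k + j)%N - s k).
  by rewrite addrA subrK.
apply: le_trans (ler_normD _ _) _; rewrite addrC; apply: lerD; first exact: tail.
by apply/ltW/js; rewrite /= leq_addl.
Unshelve. all: by end_near. Qed.

Lemma continuous_primitive (R : realType) (a b : R) (f : R -> R) :
  a <= b -> continuous f ->
  exists F : R -> R, forall t, t \in `[a, b] -> is_derive t 1 F (f t).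
Proof.
move=> ab cf.
(* Starting the integral at [a - 1] puts [a] in the interior, so that the derivative is two-sided at
   both ends of the interval. *)
exists (fun x => \int[@lebesgue_measure R]_(t in `[a - 1, x]) f t) => t; rewrite in_itv/= => /andP[at_ tb].
have [||||dF <-] := @continuous_FTC1_closed R f (a - 1) t (b + 1).
- lra.
- apply: continuous_compact_integrable; first exact: segment_compact.
  exact: continuous_subspaceT.
- lra.
- exact: cf.
by split; [exact: dF|rewrite derive1E].
Qed.

Section clamp.
Context {R : realType}.
Variables (T : R) (T0 : 0 <= T).

(** The projection onto [0, T] extends functions of time continuously to the whole line, so that
    continuity of Picard iterates need not be relativized. *)
Definition clamp (t : R) : R := Num.min (Num.max t 0) T.

Lemma clamp_itv t : clamp t \in `[0, T].
Proof. by rewrite in_itv/= /clamp ge_min lexx orbT andbT le_min le_max lexx orbT T0. Qed.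

Lemma clamp_id t : t \in `[0, T] -> clamp t = t.
Proof. by rewrite in_itv/= /clamp => /andP[t0 tT]; rewrite (max_idPl t0) (min_idPl tT). Qed.

Lemma clamp_continuous : continuous clamp.
Proof.
move=> t; apply/cvgrPdist_lt => e e0.
have := nbhsx_ballx t e e0; apply: filterS => u; rewrite -ball_normE /ball_/=.
apply: le_lt_trans; rewrite /clamp !minEle !maxEle.
rewrite ler_norml; have := ler_norm (t - u); have := ler_norm (- (t - u)); rewrite normrN.
by move=> ? ?; apply/andP; split; repeat case: ifPn; rewrite -?ltNge; lra.
Qed.

End clamp.

(** * Picard iteration on the whole of [0, T] *)

Section picard.
Context {R : realType} {n : nat}.
Local Notation V := 'rV[R]_n.+1.
Variables (T : R) (A : V -> R -> V) (K : R).
Hypotheses (T0 : 0 <= T) (K0 : 0 < K) (cA : slab_continuous T A).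
Hypothesis lipA : forall t x y, t \in `[0, T] -> `|A x t - A y t| <= K * `|x - y|.
Local Notation clT := (clamp T).

Lemma velocity_along_continuous (s : R -> V) : continuous s ->
  continuous (fun t => A (s (clT t)) (clT t)).
Proof.
move=> cs t; pose g u : V * R := (s (clT u), clT u).
have cg : g u @[u --> t] --> g t.
  have c1 : s (clT u) @[u --> t] --> s (clT t).
    by apply: (@continuous_comp _ _ _ clT s); [exact: clamp_continuous|exact: cs].
  exact: cvg_pair c1 (clamp_continuous T t).
have /subspace_continuousP/(_ (g t)) := cA.
move=> /(_ (clamp_itv T T0 t)) cAg.
suff gw : g u @[u --> t] --> within [set xt : V * R | xt.2 \in `[0, T]] (nbhs (g t)).
  exact: cvg_comp gw cAg.
move=> P Pg; have near_g : \forall u \near t, (g u).2 \in `[0, T] -> P (g u) by exact: cg Pg.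
by apply: filterS near_g => u; apply; exact: clamp_itv.
Qed.

Lemma picard_step (t1 : R) (x : V) (s : R -> V) : t1 \in `[0, T] -> continuous s ->
  exists s' : R -> V, [/\ continuous s', s' t1 = x &
    forall t, t \in `[0, T] -> deriv_within `[0, T] s' t (A (s t) t)].
Proof.
move=> t1T cs; have cv := velocity_along_continuous s cs.
have /choice[F HF] : forall i, exists F : R -> R, forall t, t \in `[0, T] ->
    is_derive t 1 F (A (s (clT t)) (clT t) 0 i).
  move=> i; apply: continuous_primitive => // t.
  by apply: (@continuous_comp _ _ _ _ (fun v : V => v 0 i)); [exact: cv|exact: coord_continuous].
(* [F i] is controlled on [0, T] only; the clamped argument makes [s'] continuous everywhere. *)
pose s' t : V := \row_i (x 0 i + F i (clT t) - F i (clT t1)).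
exists s'; split.
- move=> t; apply/cvgrPdist_le => e e0.
  have FF i : \forall u \near t, `|F i (clT t) - F i (clT u)| <= e.
    have cF : {for clT t, continuous (F i)}.
      apply: differentiable_continuous; apply/derivable1_diffP.
      by have := HF i (clT t) (clamp_itv _ T0 _); case.
    have := @continuous_comp _ _ _ clT (F i) t (clamp_continuous T t) cF.
    by move=> /cvgrPdist_le /(_ e e0).
  apply: filterS (@filter_forall _ _ _ _ (nbhs_filter t) FF) => u H.
  apply: mx_norm_le_coord => [|i]; first exact: ltW.
  rewrite /s' !mxE (_ : _ - _ = F i (clT t) - F i (clT u)); first exact: H.
  ring.
- by apply/rowP => i; rewrite mxE addrK.
- move=> t tT; apply: coord_deriv_within => i.
  have /deriv_withinP Fw := is_derive_within `[0, T] _ _ _ (HF i t tT).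
  apply/deriv_withinP => e e0; apply: filterS (Fw e e0) => u H uT.
  have uT' : u \in `[0, T] by [].
  rewrite !mxE !clamp_id//; have := H uT; rewrite clamp_id//.
  by congr (`|_ - _| <= _); ring.
Qed.

Let w t1 t : R := expR (2 * K * (t - t1)) + expR (- (2 * K) * (t - t1)).

Let dw m t1 (t : R) : is_derive t (1 : R)
  (fun t => m / 2 * (expR (2 * K * (t - t1)) - expR (- (2 * K) * (t - t1))) : R)
  (K * (m * w t1 t)).
Proof. by apply: is_derive_eq; rewrite /GRing.scale/= /w; field. Qed.

Let w_ge1 t1 t : 1 <= w t1 t.
Proof.
rewrite /w; have [le|/ltW le] := leP 0 (t - t1).
  by apply: ler_wpDr; rewrite ?expR_ge0// -expR0 ler_expR !mulr_ge0// ltW.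
apply: ler_wpDl; rewrite ?expR_ge0// -expR0 ler_expR.
by rewrite mulr_le0// oppr_le0 mulr_ge0// ltW.
Qed.

(* With weight w(t) = 2 cosh (2 K (t - t1)) the Picard operator is a
   contraction of ratio 1/2 on the whole interval, since the primitive
   of K w vanishing at t1 is bounded by w / 2. *)
Lemma picard_contraction (t1 m : R) (s1 s2 p1 p2 : R -> V) :
  t1 \in `[0, T] -> 0 <= m ->
  p1 t1 = p2 t1 ->
  (forall t, t \in `[0, T] -> deriv_within `[0, T] p1 t (A (s1 t) t)) ->
  (forall t, t \in `[0, T] -> deriv_within `[0, T] p2 t (A (s2 t) t)) ->
  (forall t, t \in `[0, T] -> `|s1 t - s2 t| <= m * w t1 t) ->
  forall t, t \in `[0, T] -> `|p1 t - p2 t| <= m / 2 * w t1 t.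
Proof.
move=> t1T m0 p12 dp1 dp2 s12 t tT.
have w0 : 0 <= w t1 t by apply: le_trans (w_ge1 t1 t).
apply: mx_norm_le_coord => [|i]; first by rewrite mulr_ge0// divr_ge0.
have dp s : s \in `[0, T] -> deriv_within `[0, T] (fun u => p1 u 0 i - p2 u 0 i : R) s
    (A (s1 s) s 0 i - A (s2 s) s 0 i).
  by move=> sT; apply: deriv_withinB; apply: deriv_within_coord; [exact: dp1|exact: dp2].
have le_dp s : s \in `[0, T] -> `|A (s1 s) s 0 i - A (s2 s) s 0 i| <= K * (m * w t1 s).
  move=> sT; have := mx_norm_coord R _ (A (s1 s) s - A (s2 s) s) i; rewrite !mxE => /le_trans; apply.
  by apply: le_trans (lipA _ _ _ sT) _; rewrite ler_pM2l//; exact: s12.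
have := @deriv_within_le_abs R 0 T _ _ _ _ dp (dw m t1) le_dp t1 t t1T tT.
rewrite p12 !subrr !mulr0 expR0 subrr mulr0 !subr0 !mxE => /le_trans; apply.
rewrite normrM ger0_norm ?divr_ge0//; apply: ler_wpM2l; first by rewrite divr_ge0.
by apply: le_trans (ler_normB _ _) _; rewrite !ger0_norm ?expR_ge0.
Qed.

Lemma ode_exists (t1 : R) (x : V) : t1 \in `[0, T] ->
  exists s, ode_solution T A t1 x s.
Proof.
move=> t1T.
(* Choice asks for a total operator; its value on discontinuous paths is irrelevant. *)
have /choice[P HP] : forall s : R -> V, exists s' : R -> V, continuous s ->
    [/\ continuous s', s' t1 = x &
    forall t, t \in `[0, T] -> deriv_within `[0, T] s' t (A (s t) t)].
  move=> s; have [cs|ncs] := pselect (continuous s); last by exists s => /ncs.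
  by have [s' ?] := picard_step t1 x s t1T cs; exists s'.
pose s k := iter k P (cst x).
have cs k : continuous (s k).
  elim: k => [|k ih]; first by move=> ?; exact: cvg_cst.
  by have [] := HP _ ih.
have sx k : s k t1 = x by case: k => // k; have [] := HP _ (cs k).
have ds k t : t \in `[0, T] -> deriv_within `[0, T] (s k.+1) t (A (s k t) t).
  by have [_ _] := HP _ (cs k); exact.
have [M M0 sM] : exists2 M, 0 <= M & forall t, t \in `[0, T] -> `|s 1%N t - s 0%N t| <= M.
  have [|c cT cmax] := @EVT_max R (fun t => `|s 1%N t - s 0%N t|) 0 T T0.
    apply: continuous_subspaceT => t; apply: cvg_norm; apply: cvgB; exact: cs.
  by exists `|s 1%N c - s 0%N c|.
have step k t : t \in `[0, T] -> `|s k.+1 t - s k t| <= M * 2^-1 ^+ k * w t1 t.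
  elim: k t => [|k ih] t tT.
    by rewrite expr0 mulr1; apply: le_trans (sM t tT) _; rewrite ler_peMr.
  have := @picard_contraction t1 (M * 2^-1 ^+ k) (s k.+1) (s k) (s k.+2) (s k.+1) t1T _ _
    (ds _) (ds _) ih t tT.
  rewrite !sx mulr_ge0 ?exprn_ge0// => /(_ isT erefl).
  by rewrite exprSr mulrA.
have /choice[S HS] : forall t, exists l, forall k,
    `|l - s k (clT t)| <= 2 * (M * w t1 (clT t)) * 2^-1 ^+ k.
  move=> t; apply: geometric_limit => k.
  by have := step k _ (clamp_itv T T0 t); rewrite mulrAC.
(* A bound for the weight on [0, T] turns the weighted rates into a uniform one, as continuity of
   the limit [S] requires. *)
have [W W0 wW] : exists2 W, 0 <= W & forall t, t \in `[0, T] -> w t1 t <= W.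
  have [|c cT cmax] := @EVT_max R (w t1) 0 T T0.
    have cexp (c : R) : continuous (fun t : R => expR (c * (t - t1))).
      move=> t; have ct : (u - t1) @[u --> t] --> t - t1.
        by apply: cvgB; [exact: cvg_id|exact: cvg_cst].
      exact: (cvg_comp _ _ (cvgMr ct) (@continuous_expR R _)).
    by apply: continuous_subspaceT => t; apply: cvgD; exact: cexp.
  by exists (w t1 c) => //; exact: le_trans (w_ge1 t1 c).
have small e : 0 < e -> exists k, 2 * (M * W) * 2^-1 ^+ k < e.
  move=> e0; have : (fun k => 2 * (M * W) * 2^-1 ^+ k) @ \oo --> 2 * (M * W) * 0.
    by apply: cvgMr; apply: cvg_expr; rewrite ger0_norm// invf_lt1// ltr1n.
  rewrite mulr0 => /cvgrPdist_lt /(_ e e0) [k _ /(_ k (leqnn k))].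
  by rewrite sub0r normrN ger0_norm ?mulr_ge0 ?exprn_ge0// => ?; exists k.
have SW t k : `|S t - s k (clT t)| <= 2 * (M * W) * 2^-1 ^+ k.
  apply: le_trans (HS t k) _; rewrite ler_wpM2r ?exprn_ge0// ler_wpM2l// ler_wpM2l//.
  exact/wW/clamp_itv.
have cS : continuous S.
  move=> t; apply/cvgrPdist_lt => e e0.
  have [k ke] := small (e / 3) (divr_gt0 e0 (ltr0n _ 3)).
  have := @continuous_comp _ _ _ clT (s k) t (clamp_continuous T t) (cs k _).
  move=> /cvgrPdist_lt /(_ (e / 3) (divr_gt0 e0 (ltr0n _ 3))).
  apply: filterS => u su.
  have -> : S t - S u = (S t - s k (clT t)) + (s k (clT t) - s k (clT u)) -
      (S u - s k (clT u)).
    by rewrite opprB !addrA !subrK.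
  apply: le_lt_trans (ler_normB _ _) _.
  apply: le_lt_trans (lerD (ler_normD _ _) (lexx _)) _.
  have := le_lt_trans (SW t k) ke; have := le_lt_trans (SW u k) ke.
  move: su => /=; lra.
have [cPS PSx dPS] := HP _ cS.
(* By contraction [P S] is as close to [s k.+1] as half the distance bound between [S] and [s k];
   and [s k.+1] tends to [S]. *)
have PSE t : t \in `[0, T] -> P S t = S t.
  move=> tT; apply/eqP; rewrite -subr_eq0 -normr_le0; apply/ler_addgt0Pr => e e0.
  rewrite add0r.
  have [k ke] := small (e / 2) (divr_gt0 e0 (ltr0n _ 2)).
  have SB u : u \in `[0, T] -> `|S u - s k u| <= 2 * M * 2^-1 ^+ k * w t1 u.
    by move=> uT; have := HS u k; rewrite clamp_id// => /le_trans; apply; rewrite le_eqVlt; apply/orP; left; apply/eqP; ring.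
  have mk0 : 0 <= 2 * M * 2^-1 ^+ k by rewrite !mulr_ge0 ?exprn_ge0.
  have := @picard_contraction t1 _ S (s k) (P S) (s k.+1) t1T mk0 _ dPS (ds k) SB t tT.
  rewrite PSx sx => /(_ erefl) PSk.
  have := SW t k.+1; rewrite clamp_id// => Sk.
  have -> : P S t - S t = (P S t - s k.+1 t) - (S t - s k.+1 t).
    by rewrite opprB addrA subrK.
  apply: le_trans (ler_normB _ _) _.
  apply: (@le_trans _ _ (e / 2 + e / 2)); last lra.
  have hk : (2^-1 : R) ^+ k.+1 = 2^-1 ^+ k / 2 by rewrite exprSr.
  have hk0 : 0 <= (2^-1 : R) ^+ k by rewrite exprn_ge0.
  have MW0 : 0 <= 2 * (M * W) * 2^-1 ^+ k by rewrite !mulr_ge0.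
  apply: lerD; last by apply: le_trans Sk _; rewrite hk mulrA; lra.
  apply: le_trans PSk _.
  apply: (@le_trans _ _ (2 * M * 2^-1 ^+ k / 2 * W)).
    by apply: ler_wpM2l; [rewrite divr_ge0|exact: wW].
  have -> : 2 * M * 2^-1 ^+ k / 2 * W = 2 * (M * W) * 2^-1 ^+ k / 2 by ring.
  lra.
(* [P S] has derivative [A (S t) t] by construction, and it agrees with [S] on [0, T]. *)
exists (P S); split=> // t tT; rewrite PSE//; exact: dPS.
Qed.

End picard.

(** * Lipschitz bound and inversion of the flow maps *)

Section flow.
Context {R : realType} {n : nat}.
Local Notation V := 'rV[R]_n.+1.
Variables (T : R) (A : V -> R -> V) (K : R).
Hypotheses (T0 : 0 <= T) (K0 : 0 < K) (cA : slab_continuous T A).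
Hypothesis lipA : forall t x y, t \in `[0, T] -> `|A x t - A y t| <= K * `|x - y|.

(** The exponential is the Gronwall factor over time at most [T] for the squared Euclidean distance,
    whose rate is [2 * n.+1%:R * K]; the factor [n.+1] compares this square with that of the max
    norm. The times themselves do not appear. *)
Definition flow_lip : R := Num.sqrt (n.+1%:R * expR (2 * n.+1%:R * K * T)).

Lemma flow_lip_gt0 : 0 < flow_lip.
Proof. by rewrite sqrtr_gt0 mulr_gt0 ?expR_gt0// ltr0n. Qed.

(* Gronwall for the squared Euclidean distance, which is differentiable,
   unlike the max norm. *)
Lemma ode_solution_lipschitz t1 t x y (s r : R -> V) : t1 \in `[0, T] -> t \in `[0, T] ->
  ode_solution T A t1 x s -> ode_solution T A t1 y r ->
  `|s t - r t| <= flow_lip * `|x - y|.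
Proof.
move=> t1T tT [sx ds] [ry dr].
pose d i u : R := s u 0 i - r u 0 i.
pose dd i u : R := A (s u) u 0 i - A (r u) u 0 i.
pose e u : R := \sum_i d i u ^+ 2.
pose de u : R := \sum_i 2 * d i u * dd i u.
have dw i u : u \in `[0, T] -> deriv_within `[0, T] (d i) u (dd i u).
  by move=> uT; apply: deriv_withinB; apply: deriv_within_coord; [exact: ds|exact: dr].
have e0 u : 0 <= e u by apply: sumr_ge0 => i _; exact: sqr_ge0.
have norm_e u : `|s u - r u| <= Num.sqrt (e u).
  apply: mx_norm_le_coord => [|i]; first exact: sqrtr_ge0.
  rewrite -sqrtr_sqr ler_wsqrtr// /e (bigD1 i)//= !mxE lerDl sumr_ge0// => j _.
  exact: sqr_ge0.
have e_norm u : e u <= n.+1%:R * `|s u - r u| ^+ 2.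
  have -> : n.+1%:R * `|s u - r u| ^+ 2 = \sum_(i < n.+1) `|s u - r u| ^+ 2.
    by rewrite sumr_const card_ord mulr_natl.
  apply: ler_sum => i _; rewrite -(real_normK (num_real (d i u))).
  rewrite ler_sqr ?nnegrE//; have := mx_norm_coord R _ (s u - r u) i.
  by rewrite !mxE.
have ce : {within `[0, T], continuous e}.
  have -> : e = \sum_(i < n.+1) (fun u => d i u ^+ 2).
    by apply/funext => v; rewrite fct_sumE.
  apply: (big_ind (fun f : R -> R => {within `[0, T], continuous f})).
  - by move=> u; exact: cvg_cst.
  - by move=> f g cf cg u; apply: cvgD; [exact: cf|exact: cg].
  - by move=> i _ u; apply: cvgM; exact: (deriv_within_continuous _ _ _ _ (dw i)).
have dE u : 0 < u < T -> is_derive u (1 : R) e (de u).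
  move=> uT; have di i : is_derive u (1 : R) (d i) (dd i u).
    have uT' : u \in `[0, T].
      by rewrite in_itv/=; move/andP : uT => [/ltW -> /ltW ->].
    exact: (deriv_within_is_derive _ _ _ _ _ uT (dw i u uT')).
  have -> : e = \sum_(i < n.+1) (fun u => d i u ^+ 2).
    by apply/funext => v; rewrite fct_sumE.
  apply: is_derive_sum => i.
  apply: is_derive_eq; rewrite /GRing.scale/=; ring.
have de_le u : 0 < u < T -> `|de u| <= 2 * n.+1%:R * K * e u.
  move=> uT; have uT' : u \in `[0, T].
    by rewrite in_itv/=; move/andP : uT => [/ltW -> /ltW ->].
  have sq : Num.sqrt (e u) ^+ 2 = e u by rewrite sqr_sqrtr.
  have -> : 2 * n.+1%:R * K * e u = \sum_(i < n.+1) 2 * K * e u.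
    by rewrite sumr_const card_ord -mulr_natl; ring.
  apply: le_trans (ler_norm_sum _ _ _) _; apply: ler_sum => i _.
  rewrite !normrM (ger0_norm (_ : 0 <= 2))// -sq expr2.
  have hd : `|d i u| <= Num.sqrt (e u).
    by apply: le_trans (norm_e u); have := mx_norm_coord R _ (s u - r u) i; rewrite !mxE.
  have hdd : `|dd i u| <= K * Num.sqrt (e u).
    apply: (@le_trans _ _ (K * `|s u - r u|)); last by rewrite ler_pM2l.
    apply: le_trans (lipA _ _ _ uT').
    by have := mx_norm_coord R _ (A (s u) u - A (r u) u) i; rewrite !mxE.
  rewrite -!mulrA ler_pM2l// mulrCA; apply: ler_pM => //.
have := @gronwall R 0 T (2 * n.+1%:R * K) e de ce dE de_le t1 t t1T tT.
move=> le_e; apply: le_trans (norm_e t) _.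
have -> : `|x - y| = Num.sqrt (`|x - y| ^+ 2) by rewrite sqrtr_sqr normr_id.
rewrite /flow_lip -sqrtrM ?mulr_ge0 ?expR_ge0//; apply: ler_wsqrtr.
apply: le_trans le_e _.
rewrite [leRHS]mulrAC; apply: ler_pM; rewrite ?expR_ge0//.
  by have := e_norm t1; rewrite sx ry.
rewrite ler_expR ler_pM2l ?mulr_gt0// ?ltr0n//.
by move: t1T tT; rewrite !in_itv/= => /andP[? ?] /andP[? ?]; rewrite ler_norml; apply/andP; split; lra.
Qed.

Lemma flow_solution t1 x : t1 \in `[0, T] ->
  ode_solution T A t1 x (get (ode_solution T A t1 x)).
Proof.
move=> t1T; have [s sP] := @ode_exists R n T A K T0 K0 cA lipA t1 x t1T.
exact: (getI (x := s)).
Qed.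

Lemma flow_lipschitz t1 t2 x y : t1 \in `[0, T] -> t2 \in `[0, T] ->
  `|flow T A t1 t2 x - flow T A t1 t2 y| <= flow_lip * `|x - y|.
Proof.
by move=> t1T t2T; apply: (@ode_solution_lipschitz t1) => //; exact: flow_solution.
Qed.

(** The trajectory through [x] at time [t1] also solves the problem started from [y] at [t2]. The
    Lipschitz estimate with equal initial points is uniqueness, so it is the trajectory that [flow]
    picks there, up to values off [0, T]. *)
Lemma flowK t1 t2 : t1 \in `[0, T] -> t2 \in `[0, T] ->
  cancel (flow T A t1 t2) (flow T A t2 t1).
Proof.
move=> t1T t2T x; pose y := flow T A t1 t2 x.
have [sx ds] := flow_solution t1 x t1T.
have s2 : ode_solution T A t2 y (get (ode_solution T A t1 x)) by [].
have := @ode_solution_lipschitz t2 t1 y y _ _ t2T t1T (flow_solution t2 y t2T) s2.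
rewrite subrr normr0 mulr0 normr_le0 subr_eq0 => /eqP.
by rewrite sx.
Qed.

End flow.

(** * The slice estimate *)

Section square_integrable.
Context d (X : measurableType d) (R : realType).
Variable mu : {measure set X -> \bar R}.
Implicit Types f g : X -> R.

Lemma Lnorm2E f : Lnorm mu 2%:E (EFin \o f) = ((\int[mu]_x (f x ^+ 2)%:E) `^ 2^-1)%E.
Proof.
rewrite unlock /Lnorm; congr (_ `^ _)%E; apply: eq_integral => x _ /=.
by rewrite powR_mulrn// real_normK// num_real.
Qed.

Lemma Lfun2P f : f \in Lfun mu 2%:E <->
  measurable_fun setT f /\ (\int[mu]_x (f x ^+ 2)%:E < +oo)%E.
Proof.
split=> [f2|[mf f2]].
  split; first by move: f2; rewrite inE => /andP[]; rewrite inE.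
  have /integrableP[_] := Lfun2_integrable_sqr f2.
  by congr (_ < _)%E; apply: eq_integral => x _; rewrite /= ger0_norm// sqr_ge0.
rewrite inE; apply/andP; split; rewrite inE//= /finite_norm Lnorm2E.
exact: poweR_lty.
Qed.

(** Expand the square of [|f| - |g| / c], weighted by [c / 2]. The weight [c] stays free so that the
    second term can be absorbed later. *)
Lemma integral_young f g (c : R) : 0 < c ->
  measurable_fun setT f -> measurable_fun setT g ->
  (`|\int[mu]_x (f x * g x)%:E| <=
   (c / 2)%:E * \int[mu]_x (f x ^+ 2)%:E + (c^-1 / 2)%:E * \int[mu]_x (g x ^+ 2)%:E)%E.
Proof.
move=> c0 mf mg.
have mfg : measurable_fun setT (fun x => (f x * g x)%:E).
  by apply/measurable_EFinP; exact: measurable_funM.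
have ms (h : X -> R) : measurable_fun setT h -> measurable_fun setT (fun x => (h x ^+ 2)%:E).
  by move=> mh; apply/measurable_EFinP; exact: measurable_funX.
have s0 (h : X -> R) x : (0 <= (h x ^+ 2)%:E)%E by rewrite lee_fin sqr_ge0.
have k0 (k : R) : 0 < k -> 0 <= k / 2 by move=> /ltW ?; rewrite divr_ge0.
apply: le_trans (le_abse_integral mu measurableT mfg) _.
rewrite -!ge0_integralZl//; [|exact: ms|by rewrite lee_fin k0 ?invr_gt0|exact: ms|by rewrite lee_fin k0].
rewrite -ge0_integralD//; last 4 first.
- by move=> x _; rewrite mule_ge0// lee_fin k0.
- by apply: measurable_funeM; exact: ms.
- by move=> x _; rewrite mule_ge0// lee_fin k0// invr_gt0.
- by apply: measurable_funeM; exact: ms.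
apply: ge0_le_integral => //.
- exact: measurableT_comp.
- by apply: emeasurable_funD; apply: measurable_funeM; exact: ms.
move=> x _; rewrite abse_EFin -!EFinM -EFinD lee_fin.
have : 0 <= c / 2 * (`|f x| - c^-1 * `|g x|) ^+ 2 by rewrite mulr_ge0 ?k0 ?sqr_ge0.
rewrite -(real_normK (num_real (f x))) -(real_normK (num_real (g x))) normrM.
have -> : c / 2 * (`|f x| - c^-1 * `|g x|) ^+ 2 =
    c / 2 * `|f x| ^+ 2 + c^-1 / 2 * `|g x| ^+ 2 - `|f x| * `|g x|.
  by field; rewrite gt_eqF.
by rewrite subr_ge0.
Qed.

End square_integrable.

(** * Exhaustion of an open set by closed subsets *)

Section exhaustion.
Context {R : realType} {n : nat}.
Local Notation V := 'rV[R]_n.+1.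
Variable Omega : set V.

(** The points at distance at least 1/(k+1) from the complement of [Omega]; they form a closed set,
    hence a compact one when [Omega] is bounded. *)
Definition inner k : set V := [set y | forall z, `|y - z| < k.+1%:R^-1 -> Omega z].

Lemma inner_sub k : inner k `<=` Omega.
Proof. by move=> y /(_ y); rewrite subrr normr0 invr_gt0 ltr0n; exact. Qed.

Lemma inner_mono k m : (k <= m)%N -> inner k `<=` inner m.
Proof.
move=> km y yk z yz; apply: yk; apply: lt_le_trans yz _.
by rewrite lef_pV2 ?posrE ?ltr0n// ler_nat.
Qed.

Lemma closed_inner k : closed (inner k).
Proof.
rewrite -openC openE => y /= /existsNP[z] /not_implyP[yz nz].
have e0 : 0 < k.+1%:R^-1 - `|y - z| by rewrite subr_gt0.
have := nbhsx_ballx y _ e0; apply: filterS => x; rewrite -ball_normE /ball_/= => yx xk.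
apply: nz; apply: xk; rewrite (_ : x - z = (y - z) - (y - x)); last first.
  by rewrite opprB [RHS]addrC addrA subrK.
by apply: le_lt_trans (ler_normB _ _) _; rewrite -ltrBrDl.
Qed.

Lemma inner_exhaust y : open Omega -> Omega y -> exists k, inner k y.
Proof.
move=> oO Oy; have /nbhs_ballP[e /= e0 eO] := open_nbhs_nbhs (conj oO Oy).
exists (Num.truncn e^-1) => z yz; apply: eO; rewrite -ball_normE /ball_/=.
apply: lt_trans yz _; rewrite invf_plt ?posrE// ?ltr0n//; exact: truncnS_gt.
Qed.

Lemma bounded_subset (B : set V) : bounded_set Omega -> B `<=` Omega -> bounded_set B.
Proof.
by move=> [M [Mr HM]] BO; exists M; split=> // r Mr' x /BO; exact: HM.
Qed.

End exhaustion.

(** * The transport estimate on an abstract measure space *)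

Section transport_estimate.
Context d (X : measurableType d) (R : realType).
Variable mu : {measure set X -> \bar R}.
Variables (O : set X) (Om : nat -> set X) (D F D0 F0 : X -> X) (C : R) (u v : X -> R).
Hypothesis mOm : forall k, measurable (Om k).
Hypothesis Om_mono : forall k m, (k <= m)%N -> Om k `<=` Om m.
Hypothesis Om_exhaust : forall y, O y -> exists k, Om k y.
Hypotheses (mD : measurable_fun setT D) (mF : measurable_fun setT F)
           (mD0 : measurable_fun setT D0) (C0 : 0 < C).
Hypotheses (DF : cancel D F) (FD : cancel F D).
Hypothesis int_F : forall g : X -> \bar R, measurable_fun setT g ->
  (forall x, 0 <= g x)%E -> (\int[mu]_x g (F x) <= C%:E * \int[mu]_x g x)%E.
Hypothesis int_D0 : forall g : X -> \bar R, measurable_fun setT g ->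
  (forall x, 0 <= g x)%E -> (\int[mu]_x g (D0 x) <= C%:E * \int[mu]_x g x)%E.
Hypotheses (uL2 : u \_ (F @` O) \in Lfun mu 2%:E) (vL2 : v \_ (F0 @` O) \in Lfun mu 2%:E).

(* The test function whose transport to time t is u cut off to a compact part
   of the moving domain. *)
Definition transported k : X -> R := fun y => \1_(Om k) y * (u \_ (F @` O)) (F y).

Let chi k : X -> R := \1_(Om k).
Let u' : X -> R := u \_ (F @` O).
Let v' : X -> R := v \_ (F0 @` O).
Let Psi := transported.
(** The integrand, at time t, of the conserved quantity tested against [transported k]. *)
Let h k : X -> R := fun x => chi k (D x) * u' x ^+ 2.

Let mu' : measurable_fun setT u'. Proof. by have [] := (Lfun2P _ _ _ _ _).1 uL2. Qed.
Let mv' : measurable_fun setT v'. Proof. by have [] := (Lfun2P _ _ _ _ _).1 vL2. Qed.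
Let fu' : (\int[mu]_x (u' x ^+ 2)%:E < +oo)%E.
Proof. by have [] := (Lfun2P _ _ _ _ _).1 uL2. Qed.
Let fv' : (\int[mu]_x (v' x ^+ 2)%:E < +oo)%E.
Proof. by have [] := (Lfun2P _ _ _ _ _).1 vL2. Qed.

Let u'0 x : ~ O (D x) -> u' x = 0.
Proof.
move=> nO; rewrite /u' patchE; case: ifPn => //; rewrite inE => -[y Oy yx].
by exfalso; apply: nO; rewrite -yx FD.
Qed.

Let chi01 k y : chi k y = 0 \/ chi k y = 1.
Proof. by rewrite /chi indicE; case: (_ \in _); [right|left]. Qed.

Let mchi k : measurable_fun setT (chi k). Proof. exact: measurable_indic. Qed.

Lemma measurable_transported k : measurable_fun setT (transported k).
Proof. by apply: measurable_funM; [exact: mchi|exact: measurableT_comp mu' mF]. Qed.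

Let mh k : measurable_fun setT (h k).
Proof.
by apply: measurable_funM; [exact: measurableT_comp (mchi k) mD|exact: measurable_funX].
Qed.

Let mhE k : measurable_fun setT (EFin \o h k).
Proof. by apply/measurable_EFinP; exact: mh. Qed.

Let h_ge0 k x : 0 <= h k x.
Proof. by rewrite mulr_ge0 ?sqr_ge0// /chi indicE. Qed.

Let h_le k x : h k x <= u' x ^+ 2.
Proof. by rewrite /h; case: (chi01 k (D x)) => ->; rewrite ?mul0r ?mul1r// sqr_ge0. Qed.

Let msq (f : X -> R) : measurable_fun setT f -> measurable_fun setT (fun x => (f x ^+ 2)%:E).
Proof. by move=> mf; apply/measurable_EFinP; exact: measurable_funX. Qed.

Let h_fin k : (\int[mu]_x (h k x)%:E < +oo)%E.
Proof.
apply: le_lt_trans fu'; apply: ge0_le_integral => //.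
- by move=> x _; rewrite lee_fin.
- exact: mhE.
- exact: msq.
- by move=> x _; rewrite lee_fin; exact: h_le.
Qed.

(** An indicator equals its square, so the square of [Psi k] is [h k] composed with [F]. *)
Let Psi_sqr k : (\int[mu]_x (Psi k x ^+ 2)%:E <= C%:E * \int[mu]_x (h k x)%:E)%E.
Proof.
have -> : (\int[mu]_x (Psi k x ^+ 2)%:E = \int[mu]_x (h k (F x))%:E)%E.
  apply: eq_integral => x _; congr EFin; rewrite /Psi /transported /h FD exprMn -/(chi k).
  by case: (chi01 k x) => ->; rewrite ?expr1n// expr0n.
apply: (int_F (fun x => (h k x)%:E)); first exact: mhE.
by move=> x; rewrite lee_fin.
Qed.

Lemma transported_L2 k : transported k \in Lfun mu 2%:E.
Proof.
apply/Lfun2P; split; first exact: measurable_transported.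
apply: le_lt_trans (Psi_sqr k) _.
by apply: lte_mul_pinfty => //; rewrite lee_fin; exact: ltW.
Qed.

Let PsiD0_sqr k :
  (\int[mu]_x (Psi k (D0 x) ^+ 2)%:E <= (C ^+ 2)%:E * \int[mu]_x (h k x)%:E)%E.
Proof.
apply: (@le_trans _ _ (C%:E * \int[mu]_x (Psi k x ^+ 2)%:E)%E).
  apply: (int_D0 (fun x => (Psi k x ^+ 2)%:E)).
    by apply: msq; exact: measurable_transported.
  by move=> x; rewrite lee_fin sqr_ge0.
by rewrite expr2 EFinM -muleA lee_pmul2l.
Qed.

Hypothesis conserved : forall k,
  \int[mu]_(x in F @` O) (u x * transported k (D x) : R) =
  \int[mu]_(x in F0 @` O) (v x * transported k (D0 x) : R).

Let int_h k : \int[mu]_(x in F @` O) (u x * Psi k (D x) : R) =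
  fine (\int[mu]_x (h k x)%:E).
Proof.
rewrite /Rintegral; congr fine; rewrite integral_mkcond; apply: eq_integral => x _.
rewrite patchE /h /Psi /transported DF /u' !patchE.
case: ifPn => xG; last by rewrite /point/= expr0n mulr0.
by rewrite xG; congr EFin; rewrite -/(chi k); ring.
Qed.

Let int_v k : \int[mu]_(x in F0 @` O) (v x * Psi k (D0 x) : R) =
  fine (\int[mu]_x (v' x * Psi k (D0 x))%:E).
Proof.
rewrite /Rintegral; congr fine; rewrite integral_mkcond; apply: eq_integral => x _.
by rewrite patchE /v' patchE; case: ifPn => _ //; rewrite /point/= mul0r.
Qed.

(** By conservation the integral of [h k] equals that of [v' * Psi k \o D0]. Young's weight [C ^+ 2]
    cancels the constant of [PsiD0_sqr], and half of the finite integral of [h k] moves to the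
    left. *)
Let h_bound k : (\int[mu]_x (h k x)%:E <= (C ^+ 2)%:E * \int[mu]_x (v' x ^+ 2)%:E)%E.
Proof.
have C20 : 0 < C ^+ 2 by rewrite exprn_gt0.
have h0 : (0 <= \int[mu]_x (h k x)%:E)%E by apply: integral_ge0 => x _; rewrite lee_fin.
have v0 : (0 <= \int[mu]_x (v' x ^+ 2)%:E)%E.
  by apply: integral_ge0 => x _; rewrite lee_fin sqr_ge0.
have hfin : (\int[mu]_x (h k x)%:E)%E \is a fin_num by rewrite ge0_fin_numE//; exact: h_fin.
have vfin : (\int[mu]_x (v' x ^+ 2)%:E)%E \is a fin_num by rewrite ge0_fin_numE.
have mPD0 : measurable_fun setT (fun x => Psi k (D0 x)).
  exact: measurableT_comp (measurable_transported k) mD0.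
have := conserved k; rewrite int_h int_v => hE.
have young := integral_young _ _ _ mu v' (fun x => Psi k (D0 x)) _ C20 mv' mPD0.
have {young} : (`|\int[mu]_x (v' x * Psi k (D0 x))%:E| <=
    (C ^+ 2 / 2)%:E * \int[mu]_x (v' x ^+ 2)%:E + (2^-1)%:E * \int[mu]_x (h k x)%:E)%E.
  apply: le_trans young _; apply: leeD => //.
  apply: (@le_trans _ _ (((C ^+ 2)^-1 / 2)%:E * ((C ^+ 2)%:E * \int[mu]_x (h k x)%:E))%E).
    apply: lee_wpmul2l; last exact: PsiD0_sqr.
    by rewrite lee_fin divr_ge0// invr_ge0 ltW.
  rewrite muleA -EFinM (_ : (C ^+ 2)^-1 / 2 * C ^+ 2 = 2^-1)//.
  by field; rewrite gt_eqF.
rewrite -(fineK hfin) -(fineK vfin) hE.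
set W := fine (\int[mu]_x (v' x ^+ 2)%:E).
(* Conservation only concerns the [fine] part of this integral; infinite values are excluded by the
   bound just obtained. *)
case: (\int[mu]_x (v' x * Psi k (D0 x))%:E)%E => [y||]//=.
rewrite -!EFinM -EFinD !lee_fin; have := ler_norm y; lra.
Qed.

(** [h_bound] is uniform in [k], and [h k] increases to the square of [u']: points sent into [O] are
    eventually in [Om k], and elsewhere [u'] vanishes. *)
Lemma transport_estimate :
  (\int[mu]_x (u' x ^+ 2)%:E <= (C ^+ 2)%:E * \int[mu]_x (v' x ^+ 2)%:E)%E.
Proof.
have ndh x : nondecreasing_seq (fun k => (h k x)%:E).
  apply/nondecreasing_seqP => k; rewrite lee_fin /h.
  apply: ler_wpM2r; first exact: sqr_ge0.
  rewrite /chi !indicE; have [xk|] := boolP (D x \in Om k) => //.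
  rewrite (_ : D x \in Om k.+1)//.
  by move: xk; rewrite !inE; exact: Om_mono.
have hlim x : limn (fun k => (h k x)%:E) = (u' x ^+ 2)%:E.
  have [Ox|nO] := pselect (O (D x)); last first.
    by rewrite u'0// expr0n (_ : (fun k => _) = cst 0%E) ?lim_cst//;
      apply/funext => k; rewrite /h u'0// expr0n mulr0.
  have [k0 Dk0] := Om_exhaust (D x) Ox.
  apply: lim_near_cst => //; exists k0 => // k /= k0k.
  by rewrite /h /chi indicE mem_set ?mul1r//; exact: Om_mono k0k _ Dk0.
have := @monotone_convergence _ _ _ mu setT measurableT (fun k => EFin \o h k)
  mhE (fun k x _ => h_ge0 k x) (fun x _ => ndh x).
under eq_integral do rewrite hlim.
move=> ->; apply: lime_le; last exact: nearW.
apply: ereal_nondecreasing_is_cvgn => k m km; apply: ge0_le_integral => //.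
- by move=> x _; rewrite lee_fin.
- by move=> x _; exact: ndh.
Qed.

End transport_estimate.

(** * Admissible test functions and the estimate for Lebesgue measure *)

Section slice_estimate.
Context {R : realType} {n : nat}.
Local Notation V := 'rV[R]_n.+1.
Local Notation leb := (lebesgue_rV R n).
Local Notation L := (caratheodory_type (@lebesgue_outer R n)).

Lemma ess_support_sub (f : V -> R) (S : set V) : closed S ->
  (forall y, ~ S y -> f y = 0) -> ess_support f `<=` S.
Proof.
move=> cS fS y yf; apply: contrapT => nSy.
apply: (yf (~` S)); last by apply: aeW => z nSz; exact: fS.
by apply: open_nbhs_nbhs; split=> //; exact: closed_openC.
Qed.

Lemma closed_ess_support (f : V -> R) : closed (ess_support f).
Proof.
rewrite -openC openE => y /= /existsNP[W] /not_implyP[yW /contrapT fW].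
have [B [[oB By] BW]] : exists B, open_nbhs y B /\ B `<=` W.
  by move: yW; rewrite nbhsE => -[B ? ?]; exists B.
apply: filterS (open_nbhs_nbhs (conj oB By)) => z Bz /(_ B (open_nbhs_nbhs (conj oB Bz))).
apply; have [N [mN N0 fN]] := fW; exists N; split=> // x /= nB; apply: fN => /= nW.
by apply: nB => /BW.
Qed.

Variables (Omega : set V) (D F D0 F0 : V -> V) (K : R) (u v : V -> R).
Hypotheses (oO : open Omega) (bO : bounded_set Omega) (K0 : 0 < K).
Hypotheses (DK : forall x y, `|D x - D y| <= K * `|x - y|)
           (FK : forall x y, `|F x - F y| <= K * `|x - y|)
           (D0K : forall x y, `|D0 x - D0 y| <= K * `|x - y|)
           (F0K : forall x y, `|F0 x - F0 y| <= K * `|x - y|).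
Hypotheses (DF : cancel D F) (FD : cancel F D) (DF0 : cancel D0 F0) (FD0 : cancel F0 D0).
Hypotheses (uL2 : in_L2 (F @` Omega) u) (vL2 : in_L2 (F0 @` Omega) v).
Hypothesis conserved : forall Psi, in_H0 Omega Psi ->
  \int[leb]_(x in F @` Omega) (u x * Psi (D x) : R) =
  \int[leb]_(x in F0 @` Omega) (v x * Psi (D0 x) : R).

Let C : R := (6 * K) ^+ n.+1.

Lemma slice_estimate :
  (\int[leb]_x ((u \_ (F @` Omega)) x ^+ 2)%:E <=
   (C ^+ 2)%:E * \int[leb]_x ((v \_ (F0 @` Omega)) x ^+ 2)%:E)%E.
Proof.
have C0 : 0 < C by rewrite exprn_gt0// mulr_gt0.
have mOm k : (measurable : set (set L)) (inner Omega k).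
  by apply: closed_lebesgue_measurable; exact: closed_inner.
have mD := bilipschitz_measurable D F K K0 FK DK DF FD.
have mF := bilipschitz_measurable F D K K0 DK FK FD DF.
have mD0 := bilipschitz_measurable D0 F0 K K0 F0K D0K DF0 FD0.
have intF := ge0_integral_bilipschitz F D K K0 DK FK FD DF.
have intD0 := ge0_integral_bilipschitz D0 F0 K K0 F0K D0K DF0 FD0.
apply: (transport_estimate _ L R leb Omega (inner Omega) D F D0 F0 C u v mOm
  (fun k m => inner_mono Omega k m) (fun y => inner_exhaust Omega y oO)
  mD mF mD0 C0 DF FD intF intD0 uL2 vL2).
move=> k; apply: conserved.
(* The cut-off keeps the essential support inside the closed set [inner Omega k]; it is then bounded
   and closed, hence compact, and contained in [Omega]. *)
have supp : ess_support (transported _ L R Omega (inner Omega) F u k) `<=` inner Omega k.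
  apply: ess_support_sub => [|y ny]; first exact: closed_inner.
  by rewrite /transported indicE memNset// mul0r.
have suppO := subset_trans supp (@inner_sub _ _ Omega k).
split=> //.
  rewrite /in_L2 /in_Lp patch_setT.
  exact: (transported_L2 _ L R leb Omega (inner Omega) D F C u mOm mD mF C0 FD intF uL2).
apply: bounded_closed_compact; last exact: closed_ess_support.
exact: bounded_subset suppO.
Qed.

End slice_estimate.

(** * Uniform bound on the slices and conclusion *)

Lemma completed_lebesgue_itv (R : realType) (a b : R) :
  measurable (`[a, b]%classic : set (caratheodory_type (wlength idfun)^*%mu)) /\
  (@completed_lebesgue_measure R `[a, b]%classic < +oo)%E.
Proof.
have mab : measurable (`[a, b]%classic : set (measurableTypeR R)) by exact: measurable_itv.
split; first by apply: (@sub_caratheodory _ _ _ (wlength (idfun : R -> R))); exact: mab.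
have : (@lebesgue_measure R `[a, b]%classic < +oo)%E.
  by rewrite lebesgue_measure_itv/=; case: ifPn => _; rewrite ?ltry// -EFinB ltry.
exact.
Qed.

Lemma slice_norm_bounded (R : realType) (n : nat) (T : R)
    (Omega : set 'rV[R]_n.+1) (A : 'rV[R]_n.+1 -> R -> 'rV[R]_n.+1) (LA : R)
    (U0 : 'rV[R]_n.+1 -> R) (U : 'rV[R]_n.+1 -> R -> R) :
  0 < T -> open Omega -> bounded_set Omega -> C1_velocity T A -> 0 < LA ->
  (forall x t, t \in `[0, T] -> op_norm (spatial_jacobian A t x) <= LA) ->
  model_solution T A Omega U0 U ->
  exists M, forall t, t \in `[0, T] -> `|slice_norm T A Omega U t| <= M.
Proof.
move=> T_gt0 oO bO A_C1 LA_gt0 jac_le [[UL2 _] _ cons].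
have T0 := ltW T_gt0.
pose K := n.+1%:R * LA.
have K0 : 0 < K by rewrite mulr_gt0// ltr0n.
have [cA _ _] := A_C1.
have lipA t x y : t \in `[0, T] -> `|A x t - A y t| <= K * `|x - y|.
  exact: velocity_lipschitz.
have TT : T \in `[0, T] by rewrite in_itv/= T0 lexx.
have zT : 0 \in `[0, T] by rewrite in_itv/= T0 lexx.
have flip t1 t2 x y := @flow_lipschitz R n T A K T0 K0 cA lipA t1 t2 x y.
have fK t1 t2 := @flowK R n T A K T0 K0 cA lipA t1 t2.
pose C := (6 * flow_lip T K (n := n)) ^+ n.+1.
pose B := ((C ^+ 2)%:E *
  \int[lebesgue_rV R n]_x (((U ^~ 0) \_ (moving_domain T A Omega 0)) x ^+ 2)%:E)%E.
have int_fin t : t \in `[0, T] ->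
    (\int[lebesgue_rV R n]_x (((U ^~ t) \_ (moving_domain T A Omega t)) x ^+ 2)%:E)%E
      \is a fin_num.
  move=> tT; have /Lfun2P[_ ?] := UL2 t tT.
  by rewrite ge0_fin_numE//; apply: integral_ge0 => x _; rewrite lee_fin sqr_ge0.
have B_fin : B \is a fin_num by rewrite fin_numM//; exact: int_fin.
exists (fine (B `^ 2^-1)%E) => t tT.
rewrite /slice_norm /Lp_norm ger0_norm ?fine_ge0 ?Lnorm_ge0// Lnorm2E.
have I0 s : (0 <= \int[lebesgue_rV R n]_x
    (((U ^~ s) \_ (moving_domain T A Omega s)) x ^+ 2)%:E)%E.
  by apply: integral_ge0 => x _; rewrite lee_fin sqr_ge0.
have B0 : (0 <= B)%E by rewrite mule_ge0// lee_fin sqr_ge0.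
apply: fine_le; [exact/fin_num_poweR/int_fin|exact: fin_num_poweR|].
apply: gt0_ler_poweR; rewrite ?in_itv/= ?I0 ?B0 ?leey//.
apply: (@slice_estimate R n Omega (flow T A t T) (flow T A T t) (flow T A 0 T)
  (flow T A T 0) (flow_lip T K) (U ^~ t) (U ^~ 0)) => //.
- exact: flow_lip_gt0.
- by move=> x y; exact: flip.
- by move=> x y; exact: flip.
- by move=> x y; exact: flip.
- by move=> x y; exact: flip.
- exact: fK.
- exact: fK.
- exact: fK.
- exact: fK.
- exact: UL2.
- exact: UL2.
(* The one-sided derivative vanishes on all of [0, T], end points included, so the conserved
   quantity has the same value at times [t] and 0. *)
move=> Psi HPsi.
exact: (deriv_within0_cst _ _ _ (cons Psi HPsi) t 0 tT zT).
Qed.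

Theorem theorem6p1 (R : realType) (n : nat) (T : R) (T_gt0 : 0 < T)
    (Omega : set 'rV[R]_n.+1) (Omega_open : open Omega)
    (Omega_bounded : bounded_set Omega)
    (A : 'rV[R]_n.+1 -> R -> 'rV[R]_n.+1) (A_C1 : C1_velocity T A)
    (LA : R) (LA_gt0 : 0 < LA)
    (jac_le : forall x t, t \in `[0, T] ->
      op_norm (spatial_jacobian A t x) <= LA)
    (U0 : 'rV[R]_n.+1 -> R) (U0_L2 : in_L2 (moving_domain T A Omega 0) U0)
    (U : 'rV[R]_n.+1 -> R -> R) (U_sol : model_solution T A Omega U0 U) :
  (forall q : \bar R, (1 <= q)%E -> in_LqH T A Omega q U) /\
  LqH_norm T A Omega q%:E U @[q --> +oo] --> LqH_norm T A Omega +oo%E U.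

Proof.
have [M UM] := @slice_norm_bounded R n T Omega A LA U0 U T_gt0 Omega_open
  Omega_bounded A_C1 LA_gt0 jac_le U_sol.
have [[UL2 UL1] _ _] := U_sol.
have [mI fI] := completed_lebesgue_itv R 0 T.
pose f := slice_norm T A Omega U \_ `[0, T].
(* Measurability in time is read off from the membership of the slice norm in L^1. *)
have mf : measurable_fun setT (f : caratheodory_type (wlength idfun)^*%mu -> R).
  by move: UL1; rewrite /in_Lp inE => /andP[]; rewrite inE.
have f0 t : ~ `[0, T]%classic t -> f t = 0 by move=> tT; rewrite /f patchE memNset.
have M0 : 0 <= M.
  by apply: le_trans (UM 0 _) => //; rewrite in_itv/= lexx ltW.
have fM t : `|f t| <= M.
  rewrite /f patchE; case: ifPn => [|_]; last by rewrite /point/= normr0.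
  by rewrite inE; exact: UM.
split=> [q q1|].
  by split=> //; exact: (@bounded_Lfun _ _ _ (@completed_lebesgue_measure R) _ _ _ mI fI mf f0 fM).
exact: (@Lnorm_cvg_Loo _ _ _ (@completed_lebesgue_measure R) _ _ _ mI fI mf f0 fM).
Qed.
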